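(* Let $(\mathcal{X},Q,\pi)$ be a Markov triple, let $\Lambda$ be an admissible mean, and let $\mathcal{W}$ be the associated discrete transport distance. For all $\mu_0,\mu_1\in\mathcal{P}(\mathcal{X})$ we have $$\frac12\mathcal{W}^2(\mu_0,\mu_1)=\sup\big\{\langle\phi_1,\mu_1\rangle-\langle\phi_0,\mu_0\rangle\;:\;\phi\in\mathsf{HJ}^1_{\mathcal{X}}\big\},$$ where $\mathsf{HJ}^1_{\mathcal{X}}$ is the set of Hamilton--Jacobi subsolutions on $\mathcal{X}$ over the time interval $(0,1)$. This representation remains true if the supremum is restricted to the functions $\phi\in C^1([0,1],\mathbb{R}^{\mathcal{X}})$ that belong to $\mathsf{HJ}^1_{\mathcal{X}}$, i.e. that satisfy $\langle\dot\phi_t,\mu\rangle+\frac12\|\nabla\phi_t\|_\mu^2\le 0$ for all $\mu\in\mathcal{P}(\mathcal{X})$ and a.e. $t\in(0,1)$.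
   Context: Markov triple: $\mathcal{X}$ is a finite set; $Q:\mathcal{X}\times\mathcal{X}\to\mathbb{R}_+=[0,\infty)$ are transition rates with $Q(x,x)=0$; $Q$ is irreducible (any $x,y\in\mathcal{X}$ are connected by a path $x=x_0,\dots,x_n=y$ with $Q(x_{i-1},x_i)>0$); $\pi$ is the unique (strictly positive) stationary probability measure; and $Q$ is reversible: $\pi(x)Q(x,y)=\pi(y)Q(y,x)$ for all $x,y$. $\mathcal{P}(\mathcal{X})$ is the set of probability measures on $\mathcal{X}$, identified with their weight functions in $\mathbb{R}^{\mathcal{X}}$. Admissible mean: a continuous function $\Lambda:\mathbb{R}_+\times\mathbb{R}_+\to\mathbb{R}_+$ that is $C^\infty$ on $(0,\infty)^2$, symmetric, positively $1$-homogeneous, non-decreasing in each variable, jointly concave, with $\Lambda(1,1)=1$. Action: let $A:\mathbb{R}^3\to[0,\infty]$, $A(s,t,w)=w^2/\Lambda(s,t)$ if $w\in\mathbb{R}$ and $s,t>0$; $A(s,t,w)=0$ if $w=0$ and $s,t\ge0$; $A(s,t,w)=+\infty$ otherwise. For $\mu\in\mathcal{P}(\mathcal{X})$, $V:\mathcal{X}\times\mathcal{X}\to\mathbb{R}$ put $\mathcal{A}(\mu,V)=\frac12\sum_{x,y\in\mathcal{X}}A(\mu(x)Q(x,y),\mu(y)Q(y,x),V(x,y))$. Continuity equation: $\mathsf{CE}_1(\mu_0,\mu_1)$ is the set of pairs $(\mu,V)$ with $\mu:[0,1]\to\mathcal{P}(\mathcal{X})$ continuous, $V:[0,1]\to\mathbb{R}^{\mathcal{X}\times\mathcal{X}}$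 locally integrable, $\mu|_{t=0}=\mu_0$, $\mu|_{t=1}=\mu_1$, and, in the sense of distributions, $\frac{d}{dt}\mu_t(x)+\frac12\sum_{y\in\mathcal{X}}(V_t(x,y)-V_t(y,x))=0$ for all $x\in\mathcal{X}$. Discrete transport distance: $\mathcal{W}(\mu_0,\mu_1)=\inf\big\{\sqrt{\int_0^1\mathcal{A}(\mu_t,V_t)\,dt}:(\mu,V)\in\mathsf{CE}_1(\mu_0,\mu_1)\big\}$. Notation: $\langle\phi,\psi\rangle=\sum_{x}\phi(x)\psi(x)$; $\nabla\phi(x,y)=\phi(y)-\phi(x)$; for $\Phi\in\mathbb{R}^{\mathcal{X}\times\mathcal{X}}$, $\|\Phi\|_\mu^2=\frac12\sum_{x,y}\Phi(x,y)^2\,\Lambda(\mu(x)Q(x,y),\mu(y)Q(y,x))$. Hamilton--Jacobi subsolutions: for $S>0$, $\mathsf{HJ}^S_{\mathcal{X}}$ is the set of $\phi\in H^1((0,S);\mathbb{R}^{\mathcal{X}})$ (taken with their continuous representatives on $[0,S]$) such that for a.e. $t\in(0,S)$, $\langle\dot\phi_t,\mu\rangle+\frac12\|\nabla\phi_t\|_\mu^2\le0$ for all $\mu\in\mathcal{P}(\mathcal{X})$. *)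

(* Defs.v *)
From HB Require Import structures.
From mathcomp Require Import all_boot all_order all_algebra.
From mathcomp Require Import all_classical all_reals all_analysis.

Set Implicit Arguments.
Unset Strict Implicit.
Unset Printing Implicit Defensive.

Import Order.TTheory GRing.Theory Num.Theory.
Import numFieldNormedType.Exports.

Local Open Scope classical_set_scope.
Local Open Scope ring_scope.

Section Markov.
Context {R : realType} {X : finType}.
Implicit Types (Q : X -> X -> R) (p : X -> R).

Definition is_prob p : Prop := (forall x, 0 <= p x) /\ \sum_x p x = 1.

Definition stationary Q p : Prop :=
  forall y, \sum_x p x * Q x y = p y * \sum_z Q y z.

Definition irreducible_rates Q : Prop :=
  forall x y, connect [rel u v | 0 < Q u v] x y.

Record markov_triple Q p : Prop := MarkovTriple {
  mt_rate_ge0 : forall x y, 0 <= Q x y ;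
  mt_rate_diag : forall x, Q x x = 0 ;
  mt_irreducible : irreducible_rates Q ;
  mt_prob : is_prob p ;
  mt_pos : forall x, 0 < p x ;
  mt_stationary : stationary Q p ;
  mt_unique : forall q, is_prob q -> stationary Q q -> q = p ;
  mt_reversible : forall x y, p x * Q x y = p y * Q y x
}.

End Markov.

Section Mean.
Context {R : realType}.
Implicit Types (F : R * R -> R) (Lam : R -> R -> R).

Definition partial (second : bool) F : R * R -> R :=
  fun p => 'D_(if second then (0, 1) else (1, 0)) F p.

Definition iter_partial (w : seq bool) F : R * R -> R := foldr partial F w.

Definition smooth_on (U : set (R * R)) F : Prop :=
  forall (w : seq bool) (p : R * R), U p ->
    [/\ {for p, continuous (iter_partial w F)},
        derivable (iter_partial w F) p (1, 0) &
        derivable (iter_partial w F) p (0, 1)].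

(* Only the values of [Lam] on the closed quadrant are meaningful. *)
Record admissible_mean Lam : Prop := AdmissibleMean {
  am_ge0 : forall s t, 0 <= s -> 0 <= t -> 0 <= Lam s t ;
  am_continuous :
    {within [set p : R * R | 0 <= p.1 /\ 0 <= p.2],
       continuous (fun p : R * R => Lam p.1 p.2)} ;
  am_smooth :
    smooth_on [set p : R * R | 0 < p.1 /\ 0 < p.2] (fun p => Lam p.1 p.2) ;
  am_sym : forall s t, 0 <= s -> 0 <= t -> Lam s t = Lam t s ;
  am_homogeneous : forall c s t, 0 < c -> 0 <= s -> 0 <= t ->
    Lam (c * s) (c * t) = c * Lam s t ;
  am_mono : forall s s' t t', 0 <= s -> s <= s' -> 0 <= t -> t <= t' ->
    Lam s t <= Lam s' t' ;
  am_concave : forall a s t s' t', 0 <= a -> a <= 1 ->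
    0 <= s -> 0 <= t -> 0 <= s' -> 0 <= t' ->
    a * Lam s t + (1 - a) * Lam s' t'
      <= Lam (a * s + (1 - a) * s') (a * t + (1 - a) * t') ;
  am_11 : Lam 1 1 = 1
}.

End Mean.

Section Curves.
Context {R : realType}.
Implicit Types (S : R) (f g eta : R -> R).

Definition test_function S eta : Prop :=
  (forall n t, derivable (eta^`(n))%classic t 1) /\
  exists a b, [/\ 0 < a, b < S & forall t, t \notin `[a, b] -> eta t = 0].

(* [g] is the distributional derivative of [f] on (0, S). *)
Definition weak_derivative S f g : Prop :=
  forall eta, test_function S eta ->
    \int[lebesgue_measure]_(t in `]0, S[) (f t * (eta^`())%classic t) =
    - \int[lebesgue_measure]_(t in `]0, S[) (g t * eta t).

Definition square_integrable (D : set R) f : Prop :=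
  measurable_fun D f /\
  (\int[lebesgue_measure]_(t in D) ((f t ^+ 2)%:E) < +oo)%E.

(* [f] is the continuous representative, on [0, S], of an element of
   H^1(0, S), and [g] is a version of its weak derivative. *)
Definition H1_with_derivative S f g : Prop :=
  [/\ {within `[0, S], continuous f},
      square_integrable `]0, S[ f,
      square_integrable `]0, S[ g &
      weak_derivative S f g].

Definition C1_segment S f : Prop :=
  derivable_oo_LRcontinuous f 0 S /\
  exists g, {within `[0, S], continuous g} /\ {in `]0, S[, (f^`())%classic =1 g}.

End Curves.

Section Transport.
Context {R : realType} {X : finType}.
Variables (Q : X -> X -> R) (Lam : R -> R -> R).

Definition action_density (s t w : R) : \bar R :=
  if (0 < s) && (0 < t) then (w ^+ 2 / Lam s t)%:E
  else if [&& w == 0, 0 <= s & 0 <= t] then 0%E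
  else +oo%E.

Definition action (mu : X -> R) (V : X -> X -> R) : \bar R :=
  ((2^-1)%:E * \sum_x \sum_y
     action_density (mu x * Q x y)%R (mu y * Q y x)%R (V x y))%E.

(* Values of [mu] and [V] outside [0, 1] are irrelevant. On the compact
   interval [0, 1], local integrability is integrability. *)
Record continuity_eq (mu0 mu1 : X -> R)
    (mu : R -> X -> R) (V : R -> X -> X -> R) : Prop := ContinuityEq {
  ce_prob : forall t, t \in `[0, 1] -> is_prob (mu t) ;
  ce_continuous : forall x, {within `[0, 1], continuous (fun t => mu t x)} ;
  ce_integrable : forall x y,
    lebesgue_measure.-integrable `[0, 1] (fun t => (V t x y)%:E) ;
  ce_start : mu 0 = mu0 ;
  ce_end : mu 1 = mu1 ;
  ce_eq : forall x, weak_derivative 1 (fun t => mu t x)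
    (fun t => - (2^-1 * \sum_y (V t x y - V t y x)))
}.

Definition transport_distance (mu0 mu1 : X -> R) : \bar R :=
  ereal_inf [set c : \bar R | exists mu V, continuity_eq mu0 mu1 mu V /\
    c = sqrte (\int[lebesgue_measure]_(t in `[0%R, 1%R]) action (mu t) (V t))%E].

Definition pairing (phi psi : X -> R) : R := \sum_x phi x * psi x.

Definition grad (phi : X -> R) (x y : X) : R := phi y - phi x.

Definition sqnorm (mu : X -> R) (Phi : X -> X -> R) : R :=
  2^-1 * \sum_x \sum_y Phi x y ^+ 2 * Lam (mu x * Q x y) (mu y * Q y x).

Definition HJ (S : R) (phi : R -> X -> R) : Prop :=
  exists dphi : R -> X -> R,
    (forall x, H1_with_derivative S (fun t => phi t x) (fun t => dphi t x)) /\
    {ae lebesgue_measure, forall t, t \in `]0, S[ ->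
       forall mu, is_prob mu ->
         pairing (dphi t) mu + 2^-1 * sqnorm mu (grad (phi t)) <= 0}.

End Transport.

(* Main.v *)
Require Import Defs.
From HB Require Import structures.
From mathcomp Require Import all_boot all_order all_algebra finmap.
From mathcomp Require Import all_classical all_reals all_analysis.
From mathcomp Require Import measurable_realfun ring lra zify.

(** The distance is an infimum over curves of measures and the right-hand side a
supremum over potentials, so the theorem is a convex duality without gap.

Weak duality is a computation. A curve solving the continuity equation and a
subsolution are both absolutely continuous (du Bois-Reymond's lemma,
[weak_derivative_density]), hence the product rule applies to their pairing
([product_rule]). Its time derivative is bounded by half the action, through
the subsolution property and Young's inequality on every edge
([action_density_young], [dual_le_transport]).

For strong duality the interval is cut into [n] cells. A discrete potential is a
sequence [c 0, ..., c n], and in each cell its difference quotient is tested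
against the Hamiltonian at both ends of the cell ([discrete_HJ]). Bernstein
polynomials interpolate such a sequence by a subsolution that is polynomial in
time and has the same end points ([bernstein_HJ]): convexity of the Hamiltonian
and the recursion between Bernstein polynomials of consecutive degrees leave no
error term. A bound [D] for the continuous problem is therefore a bound for
every discrete one.

The multipliers of the discrete constraints range over a compact simplex, and a
minimax theorem ([minimax], [discrete_minimax]) provides a single multiplier
bounding the Lagrangian for all potentials. Summation by parts decouples that
Lagrangian into one quadratic problem for each potential, and the Fredholm
alternative reads off a discrete curve of measures driven by gradient fluxes
whose total energy is at most the bound ([discrete_flow]).

It remains to turn this discrete curve into a curve in time. Bernstein
polynomials serve again: the continuity equation passes to the interpolant
exactly, and the action is estimated by the Cauchy-Schwarz inequality together
with the superadditivity of the mean ([bernstein_polynomial_flow]). The loss is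
the deviation from constancy of explicit ratios of Bernstein polynomials. With
[n = K ^ 2] cells and [K] waiting steps at both ends it is at most the factor
[((K + 1) / K) ^ 3] ([near_optimal_flow]). The action is finite only if the flux
vanishes wherever mass is missing; a small admixture of a flow through the
stationary measure makes the mass positive ([reference_flow]). Letting [K] tend to infinity and the
admixture to zero gives [transport_le_dual]. *)

Set Implicit Arguments.
Unset Strict Implicit.
Unset Printing Implicit Defensive.

Import Order.TTheory GRing.Theory Num.Theory.
Import numFieldNormedType.Exports.
Local Open Scope classical_set_scope.
Local Open Scope ring_scope.

(** * Means *)

Section Mean.
Context {R : realType} (Lam : R -> R -> R) (HL : admissible_mean Lam).

Lemma mean00 : Lam 0 0 = 0.
Proof.
have h : Lam (2 * 0) (2 * 0) = 2 * Lam 0 0 by apply: (am_homogeneous HL).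
by rewrite !mulr0 in h; lra.
Qed.

Lemma mean_ge0 s t : 0 <= s -> 0 <= t -> 0 <= Lam s t.
Proof. exact: (am_ge0 HL). Qed.

Lemma mean_homogeneous c s t : 0 <= c -> 0 <= s -> 0 <= t ->
  Lam (c * s) (c * t) = c * Lam s t.
Proof.
rewrite le_eqVlt => /predU1P[<- _ _|c0 s0 t0]; first by rewrite !mul0r mean00.
exact: (am_homogeneous HL).
Qed.

(** By monotonicity the mean dominates the value at the smaller argument. *)
Lemma mean_gt0 s t : 0 < s -> 0 < t -> 0 < Lam s t.
Proof.
move=> s0 t0; pose m := Num.min s t.
have m0 : 0 < m by rewrite lt_min s0.
apply: (@lt_le_trans _ _ (Lam m m)).
  by rewrite -[m]mulr1 (am_homogeneous HL) ?ler01// (am_11 HL) mulr1.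
by apply: (am_mono HL); rewrite ?(ltW m0)// ge_min lexx ?orbT.
Qed.

(** A concave function that is positively homogeneous is superadditive. *)
Lemma mean_superadditive s t s' t' : 0 <= s -> 0 <= t -> 0 <= s' -> 0 <= t' ->
  Lam s t + Lam s' t' <= Lam (s + s') (t + t').
Proof.
move=> s0 t0 s'0 t'0.
have h : 2^-1 * Lam (2 * s) (2 * t) + (1 - 2^-1) * Lam (2 * s') (2 * t') <=
  Lam (2^-1 * (2 * s) + (1 - 2^-1) * (2 * s'))
      (2^-1 * (2 * t) + (1 - 2^-1) * (2 * t')).
  by apply: (am_concave HL); rewrite ?mulr_ge0// ?invr_ge0// invf_le1// ler1n.
have e (a b : R) : 2^-1 * (2 * a) + (1 - 2^-1) * (2 * b) = a + b by field.
rewrite !e !(am_homogeneous HL) ?ltr0n// in h.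
by apply: le_trans h; rewrite e.
Qed.

Lemma mean_sum (I : Type) (r : seq I) (P : pred I) (c s t : I -> R) :
    (forall i, P i -> 0 <= c i) ->
    (forall i, P i -> 0 <= s i) -> (forall i, P i -> 0 <= t i) ->
  \sum_(i <- r | P i) c i * Lam (s i) (t i) <=
  Lam (\sum_(i <- r | P i) c i * s i) (\sum_(i <- r | P i) c i * t i).
Proof.
move=> c0 s0 t0.
suff [] : [/\ 0 <= \sum_(i <- r | P i) c i * s i,
    0 <= \sum_(i <- r | P i) c i * t i &
    \sum_(i <- r | P i) c i * Lam (s i) (t i) <=
  Lam (\sum_(i <- r | P i) c i * s i) (\sum_(i <- r | P i) c i * t i)] by [].
elim: r => [|i r [IHs IHt IH]]; first by rewrite !big_nil mean00.
rewrite !big_cons; case: ifPn => // Pi.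
split; rewrite ?addr_ge0 ?mulr_ge0 ?c0 ?s0 ?t0//.
apply: le_trans (mean_superadditive _ _ _ _); rewrite ?mulr_ge0 ?c0 ?s0 ?t0//.
by rewrite mean_homogeneous ?c0 ?s0 ?t0// lerD.
Qed.

(** Truncation retracts the plane continuously onto the closed quadrant, so that
continuity within the quadrant becomes continuity everywhere. *)
Lemma mean_continuous :
  continuous (fun p : R * R => Lam (Num.max p.1 0) (Num.max p.2 0)).
Proof.
move=> p; set A := [set p : R * R | 0 <= p.1 /\ 0 <= p.2].
pose g (p : R * R) : R * R := (Num.max p.1 0, Num.max p.2 0).
have Ag q : A (g q) by split; rewrite le_max lexx orbT.
have gp : g q @[q --> p] --> within A (nbhs (g p)).
  have gc : g q @[q --> p] --> g p.
    have cf : {for p, continuous (@fst R R : R * R -> R)} by exact: cvg_fst.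
    have cs : {for p, continuous (@snd R R : R * R -> R)} by exact: cvg_snd.
    have c0 : {for p, continuous (cst (0 : R) : R * R -> R)} by exact: cvg_cst.
    have := cvg_pair (continuous_max cf c0) (continuous_max cs c0).
    exact.
  move=> B nB; have := gc _ nB.
  rewrite /nbhs/=; apply: filterS => q; apply; exact: Ag.
have /subspace_continuousP/(_ _ (Ag p)) h := am_continuous HL.
exact: cvg_trans (cvg_app (fun p : R * R => Lam p.1 p.2) gp) h.
Qed.

End Mean.

(** * A minimax theorem on a compact set *)

Lemma continuous_sum {R : realType} {T : topologicalType} (I : Type)
    (r : seq I) (P : pred I) (F : I -> T -> R) :
  (forall i, P i -> continuous (F i)) ->
  continuous (fun m => \sum_(i <- r | P i) F i m).
Proof. by move=> cF; apply: (continuous_big _ cF); exact: add_continuous. Qed.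

Lemma continuous_mulr {R : realType} {T : topologicalType} (f : T -> R) (a : R) :
  continuous f -> continuous (fun m => f m * a).
Proof. by move=> cf m; apply: cvgM; [exact: cf|exact: cvg_cst]. Qed.

Lemma continuous_mull {R : realType} {T : topologicalType} (f : T -> R) (a : R) :
  continuous f -> continuous (fun m => a * f m).
Proof. by move=> cf m; apply: cvgM; [exact: cvg_cst|exact: cf]. Qed.

Lemma continuous_add {R : realType} {T : topologicalType} (f g : T -> R) :
  continuous f -> continuous g -> continuous (fun m => f m + g m).
Proof. by move=> cf cg m; apply: cvgD; [exact: cf|exact: cg]. Qed.

Lemma continuous_cstB {R : realType} {T : topologicalType} (f : T -> R) (a : R) :
  continuous f -> continuous (fun m => a - f m).
Proof. by move=> cf m; apply: cvgB; [exact: cvg_cst|exact: cf]. Qed.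

Lemma continuous_comp2 {R : realType} {T : topologicalType} (f g : T -> R)
    (h : R * R -> R) :
  continuous f -> continuous g -> continuous h -> continuous (fun m => h (f m, g m)).
Proof.
move=> cf cg ch m; apply: (@cvg_comp _ _ _ (fun m => (f m, g m)) h _ _ _ _ (ch _)).
exact: cvg_pair (cf m) (cg m).
Qed.

Section Minimax.
Context {R : realType} {T : ptopologicalType} (Z : set T).
Context (comb : R -> T -> T -> T).
Hypothesis Zcompact : compact Z.
Hypothesis Znonempty : Z !=set0.
Hypothesis Zcomb : forall s m m', 0 <= s <= 1 -> Z m -> Z m' ->
  Z (comb s m m').

Let convex_along (f : T -> R) := forall s m m', 0 <= s <= 1 -> Z m -> Z m' ->
  f (comb s m m') <= (1 - s) * f m + s * f m'.

(** The squared positive part is differentiable with a Lipschitz derivative; this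
is its second order upper bound along a segment. *)
Lemma sqr_posr_convex_le (u v s : R) : 0 <= s <= 1 ->
  Num.max ((1 - s) * u + s * v) 0 ^+ 2 <=
  Num.max u 0 ^+ 2 + 2 * s * (Num.max u 0 * (v - u)) + s ^+ 2 * (v - u) ^+ 2.
Proof.
move=> /andP[s0 s1].
rewrite (_ : (1 - s) * u + s * v = u + s * (v - u)); last by ring.
set d := v - u.
rewrite (_ : _ + _ + _ = (Num.max u 0 + s * d) ^+ 2); last by ring.
case: (leP 0 (u + s * d)) => h; last by rewrite expr0n/= sqr_ge0.
case: (leP 0 u) => // u0; rewrite add0r ler_sqr ?nnegrE//; first by lra.
by rewrite (le_trans h)// gerDr ltW.
Qed.

Lemma sqr_posr_mono (u v : R) : u <= v ->
  Num.max u 0 ^+ 2 <= Num.max v 0 ^+ 2.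
Proof.
move=> uv; rewrite ler_sqr ?nnegrE; last 2 first.
- by rewrite le_max lexx orbT.
- by rewrite le_max lexx orbT.
by rewrite ge_max !le_max uv lexx orbT.
Qed.

(** At a minimiser of the sum of the squared positive parts of [f j - D], the
first order condition reads off the multipliers: they are proportional to
those positive parts. *)
Lemma finite_minimax (J : finType) (f : J -> T -> R) (D : R) :
  (forall j, continuous (f j)) -> (forall j, convex_along (f j)) ->
  (forall m, Z m -> exists j, D < f j m) ->
  exists lam : J -> R, [/\ forall j, 0 <= lam j, \sum_j lam j = 1 &
    forall m, Z m -> D <= \sum_j lam j * f j m].
Proof.
move=> fcont fconv fD.
pose F m := \sum_j Num.max (f j m - D) 0 ^+ 2.
have Fcont : continuous F.
  apply: continuous_sum => j _ m.
  have c0 : {for m, continuous (cst (0 : R) : T -> R)} by exact: cvg_cst.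
  have cf : {for m, continuous ((fun m => f j m - D) : T -> R)}.
    by apply: cvgB; [exact: fcont|exact: cvg_cst].
  have h := continuous_max cf c0.
  exact: (cvgM h h).
have [m0 Zm0 minF] := compact_EVT_min Znonempty Zcompact (continuous_subspaceT Fcont).
rewrite inE in Zm0.
pose u j := f j m0 - D.
pose w j := Num.max (u j) 0.
have w0 j : 0 <= w j by rewrite /w le_max lexx orbT.
have wu j : w j * u j = w j ^+ 2.
  by rewrite /w; case: (leP 0 (u j)) => _; rewrite ?expr2 ?mul0r.
have W0 : 0 < \sum_j w j.
  have [j Dj] := fD _ Zm0.
  rewrite (bigD1 j)//= ltr_wpDr// ?sumr_ge0//.
  by rewrite /w lt_max subr_gt0 Dj.
have first_order m : Z m -> 0 <= \sum_j w j * (f j m - f j m0).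
  move=> Zm; rewrite leNgt; apply/negP => neg.
  set A := \sum_j _ in neg.
  pose B := \sum_j (f j m - f j m0) ^+ 2.
  have B0 : 0 <= B by rewrite sumr_ge0// => j _; rewrite sqr_ge0.
  (* The step [s] is short enough for the linear gain [2 * s * A] to beat the
  quadratic error [s ^+ 2 * B]. *)
  pose s := Num.min 1 (- A / (1 + B)).
  have s0 : 0 < s.
    by rewrite lt_min ltr01/= divr_gt0 ?oppr_gt0// ltr_wpDr.
  have s1 : s <= 1 by rewrite ge_min lexx.
  have s01 : 0 <= s <= 1 by rewrite (ltW s0).
  have sB : s * (1 + B) <= - A.
    by rewrite -ler_pdivlMr ?ltr_wpDr// ge_min lexx orbT.
  have Zs := Zcomb s01 Zm0 Zm.
  have : F m0 <= F m0 + 2 * s * A + s ^+ 2 * B.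
    apply: (@le_trans _ _ (F (comb s m0 m))); first by apply: minF; rewrite inE.
    rewrite /F /A /B !mulr_sumr -!big_split/= ler_sum// => j _.
    have := sqr_posr_convex_le (u j) (f j m - D) s01.
    rewrite (_ : f j m - D - u j = f j m - f j m0); last by rewrite /u; ring.
    apply: le_trans; apply: sqr_posr_mono.
    by have := fconv j _ _ _ s01 Zm0 Zm; rewrite /u; lra.
  rewrite -addrA lerDl => h; have sA : s * A < 0 by rewrite pmulr_rlt0.
  have : s * (s * (1 + B)) <= s * - A by rewrite ler_pM2l.
  have : 0 < s * s by rewrite mulr_gt0.
  by nra.
exists (fun j => w j / \sum_j w j); split.
- by move=> j; rewrite divr_ge0// ltW.
- by rewrite -mulr_suml mulfV// gt_eqF.
move=> m Zm.
under eq_bigr do rewrite mulrAC.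
rewrite -mulr_suml ler_pdivlMr// mulr_sumr -subr_ge0 -sumrB.
apply: le_trans (first_order _ Zm) _; rewrite -subr_ge0 -sumrB.
rewrite sumr_ge0// => j _.
rewrite (_ : _ - _ = w j * u j); first by rewrite wu sqr_ge0.
by rewrite /u; ring.
Qed.

(** Compactness in the first variable reduces the minimax principle to finitely
many [c], whose mixtures are available by [fconc]. *)
Lemma minimax (C : Type) (f : C -> T -> R) (D : R) :
  (forall c, continuous (f c)) -> (forall c, convex_along (f c)) ->
  (forall (J : finType) (c : J -> C) (lam : J -> R),
    (forall j, 0 <= lam j) -> \sum_j lam j = 1 ->
    exists c', forall m, Z m -> \sum_j lam j * f (c j) m <= f c' m) ->
  (forall c, exists m, Z m /\ f c m < D) ->
  exists m, Z m /\ forall c, f c m <= D.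
Proof.
move=> fcont fconv fconc fD.
have [//|none] := pselect (exists m, Z m /\ forall c, f c m <= D).
exfalso.
have cov m : Z m -> exists c, D < f c m.
  move=> Zm; have [//|nc] := pselect (exists c, D < f c m).
  exfalso; apply: none; exists m; split => // c; rewrite leNgt.
  by apply/negP => cD; apply: nc; exists c.
have := Zcompact; rewrite compact_cover.
move=> /(_ {classic C} setT (fun c => [set m | D < f c m])).
case.
- move=> c _; have := @open_comp _ _ (f c) [set x | D < x].
  by apply => //; move=> m _; exact: fcont.
- by move=> m Zm; have [c Dc] := cov _ Zm; exists c.
move=> C' _ C'cov.
have [lam [lam0 lam1 lamD]] : exists lam : fset_sub_type C' -> R, [/\ forall j, 0 <= lam j,
    \sum_j lam j = 1 & forall m, Z m -> D <= \sum_j lam j * f (val j) m].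
  apply: (finite_minimax (f := fun j : fset_sub_type C' => f (val j))) => //.
  by move=> m /C'cov[c cC' Dc]; exists [` cC']%fset.
have [c' c'f] := fconc _ (fun j : fset_sub_type C' => val j : C) _ lam0 lam1.
have [m [Zm]] := fD c'.
by rewrite ltNge (le_trans (lamD _ Zm) (c'f _ Zm)).
Qed.

End Minimax.

(** * Cauchy-Schwarz inequalities and the Hamiltonian *)

Section CauchySchwarz.
Context {R : realType}.
Implicit Types x y p q : R.

Lemma cauchy_schwarz2 x y p q p' q' : 0 <= p -> 0 <= q -> 0 <= p' -> 0 <= q' ->
  x ^+ 2 <= p * q -> y ^+ 2 <= p' * q' -> (x + y) ^+ 2 <= (p + p') * (q + q').
Proof.
move=> p0 q0 p'0 q'0 hx hy.
have cross : `|2 * (x * y)| <= p * q' + p' * q.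
  rewrite -ler_sqr ?nnegrE ?normr_ge0 ?addr_ge0 ?mulr_ge0// real_normK ?num_real//.
  have : (x * y) ^+ 2 <= (p * q) * (p' * q').
    by rewrite exprMn ler_pM// ?sqr_ge0.
  have := sqr_ge0 (p * q' - p' * q); nra.
have := le_trans (ler_norm _) cross; nra.
Qed.

Lemma cauchy_schwarz_sum (I : Type) (r : seq I) (P : pred I) (x p q : I -> R) :
    (forall i, P i -> 0 <= p i) -> (forall i, P i -> 0 <= q i) ->
    (forall i, P i -> x i ^+ 2 <= p i * q i) ->
  (\sum_(i <- r | P i) x i) ^+ 2 <=
  (\sum_(i <- r | P i) p i) * (\sum_(i <- r | P i) q i).
Proof.
move=> p0 q0 xpq; suff [] : [/\ 0 <= \sum_(i <- r | P i) p i,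
   0 <= \sum_(i <- r | P i) q i & (\sum_(i <- r | P i) x i) ^+ 2 <=
  (\sum_(i <- r | P i) p i) * (\sum_(i <- r | P i) q i)] by [].
elim: r => [|i r [IHp IHq IH]]; first by rewrite !big_nil expr0n mul0r.
rewrite !big_cons; case: ifPn => // Pi.
by split; rewrite ?addr_ge0 ?p0 ?q0// cauchy_schwarz2 ?p0 ?q0 ?xpq.
Qed.

Lemma jensen_sqr (I : Type) (r : seq I) (P : pred I) (lam a : I -> R) :
    (forall i, P i -> 0 <= lam i) -> \sum_(i <- r | P i) lam i = 1 ->
  (\sum_(i <- r | P i) lam i * a i) ^+ 2 <= \sum_(i <- r | P i) lam i * a i ^+ 2.
Proof.
move=> lam0 lam1; rewrite -[leRHS]mul1r -{1}lam1.
apply: cauchy_schwarz_sum => // i Pi; first by rewrite mulr_ge0 ?lam0 ?sqr_ge0.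
by rewrite exprMn mulrA -expr2.
Qed.

End CauchySchwarz.

Section Hamiltonian.
Context {R : realType} {X : finType}.
Variables (Q : X -> X -> R) (Lam : R -> R -> R).
Hypothesis HL : admissible_mean Lam.
Hypothesis Q0 : forall x y, 0 <= Q x y.
Implicit Types (c mu : X -> R) (a s : R).

Definition hamiltonian (c mu : X -> R) : R := 2^-1 * sqnorm Q Lam mu (grad c).

Lemma hamiltonian_concave c mu mu' s : 0 <= s <= 1 ->
  (forall x, 0 <= mu x) -> (forall x, 0 <= mu' x) ->
  (1 - s) * hamiltonian c mu + s * hamiltonian c mu' <=
  hamiltonian c (fun x => (1 - s) * mu x + s * mu' x).
Proof.
move=> /andP[s0 s1] mu0 mu'0; rewrite /hamiltonian /sqnorm.
have halves (A B : R) : (1 - s) * (2^-1 * (2^-1 * A)) + s * (2^-1 * (2^-1 * B))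
  = 2^-1 * (2^-1 * ((1 - s) * A + s * B)) by ring.
rewrite halves !ler_pM2l ?invr_gt0//.
rewrite !mulr_sumr -big_split/= ler_sum// => x _.
rewrite !mulr_sumr -big_split/= ler_sum// => y _.
rewrite !(mulrCA _ (grad c x y ^+ 2)) -mulrDr ler_wpM2l ?sqr_ge0//.
rewrite !(mulrDl _ _ (Q _ _)) -!(mulrA (1 - s)) -!(mulrA s).
rewrite -2?(mean_homogeneous HL) ?mulr_ge0// ?subr_ge0//.
by apply: (mean_superadditive HL); rewrite !mulr_ge0// subr_ge0.
Qed.

Lemma hamiltonian_jensen (I : Type) (r : seq I) (P : pred I) (lam : I -> R)
    (c : I -> X -> R) mu :
  (forall i, P i -> 0 <= lam i) -> \sum_(i <- r | P i) lam i = 1 ->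
  (forall x, 0 <= mu x) ->
  hamiltonian (fun x => \sum_(i <- r | P i) lam i * c i x) mu <=
  \sum_(i <- r | P i) lam i * hamiltonian (c i) mu.
Proof.
move=> lam0 lam1 mu0; rewrite /hamiltonian /sqnorm.
under [leRHS]eq_bigr => i _ do rewrite (mulrCA (lam i)) (mulrCA (lam i)).
rewrite -!mulr_sumr !ler_pM2l ?invr_gt0//.
under [leRHS]eq_bigr do rewrite mulr_sumr.
rewrite [leRHS]exchange_big/= ler_sum// => x _.
under [leRHS]eq_bigr do rewrite mulr_sumr.
rewrite [leRHS]exchange_big/= ler_sum// => y _.
under [leRHS]eq_bigr do rewrite mulrA.
rewrite -mulr_suml ler_wpM2r ?(mean_ge0 HL) ?mulr_ge0//.
rewrite /grad -sumrB; under eq_bigr do rewrite -mulrBr.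
exact: jensen_sqr.
Qed.

Lemma hamiltonian_shift c a mu : hamiltonian (fun x => c x - a) mu = hamiltonian c mu.
Proof.
rewrite /hamiltonian /sqnorm; do 2 congr (_ * _).
apply: eq_bigr => x _; apply: eq_bigr => y _; congr (_ ^+ 2 * _).
by rewrite /grad; ring.
Qed.

End Hamiltonian.

(** * The discrete dual problem *)

(** The topology of pointwise convergence, with a base point so that compactness
can be expressed by covers. *)
Definition weights (R : realType) (I : eqType) := prod_topology (fun _ : I => R).
HB.instance Definition _ (R : realType) (I : eqType) :=
  Topological.on (weights R I).
HB.instance Definition _ (R : realType) (I : eqType) :=
  isPointed.Build (weights R I) (fun _ => 0).

Section Discrete.
Context {R : realType} {X : finType}.
Variables (Q : X -> X -> R) (Lam : R -> R -> R).
Hypothesis HL : admissible_mean Lam.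
Hypothesis Q0 : forall x y, 0 <= Q x y.
Variables (mu0 mu1 : X -> R).
Hypotheses (Hmu0 : is_prob mu0) (Hmu1 : is_prob mu1).
Variable n : nat.
Hypothesis n_gt0 : (0 < n)%N.

Implicit Types (c : nat -> X -> R) (m : weights R (nat * bool * X)%type).

Definition objective c : R := pairing (c n) mu1 - pairing (c 0%N) mu0.

Definition constraint c k (e : bool) mu : R :=
  n%:R * pairing (fun x => c k.+1 x - c k x) mu +
  hamiltonian Q Lam (c (k + e)%N) mu.

(** The difference quotient on each cell is tested against the Hamiltonian at
both of its ends: this two-sided condition is what Bernstein interpolation
turns into a subsolution without any loss. *)
Definition discrete_HJ c := forall k e mu, (k < n)%N -> is_prob mu ->
  constraint c k e mu <= 0.

Definition slice m k e : X -> R := fun x => m (k, e, x).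

Definition lagrangian c m : R :=
  objective c - \sum_(k < n) \sum_(e : bool) constraint c k e (slice m k e).

Definition simplex : set (weights R (nat * bool * X)%type) :=
  [set m | (forall i, `[0, 1]%classic (m i)) /\
           \sum_(k < n) \sum_(e : bool) \sum_x m (nat_of_ord k, e, x) = 1].

Lemma slice_ge0 m k e x : simplex m -> 0 <= slice m k e x.
Proof. by move=> [m01 _]; have /= := m01 (k, e, x); rewrite in_itv/= => /andP[]. Qed.

Lemma simplex_compact : compact simplex.
Proof.
pose box : set (weights R (nat * bool * X)%type) := [set m | forall i, `[0, 1]%classic (m i)].
have cbox : compact box.
  apply: (@tychonoff _ (fun _ => R) (fun _ => `[0, 1]%classic)) => i.
  exact: segment_compact.
pose total (m : weights R (nat * bool * X)%type) : R :=
  \sum_(k < n) \sum_(e : bool) \sum_x m (nat_of_ord k, e, x).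
have ctotal : continuous total.
  do 3 (apply: continuous_sum => ? _).
  exact: (@proj_continuous _ (fun _ => R)).
apply: (compact_closedI (B := total @^-1` [set 1]) cbox).
apply: closed_comp => [m _|]; first exact: ctotal.
exact: closed_eq.
Qed.

Lemma pairing_comb (phi mu mu' : X -> R) (a b : R) :
  pairing phi (fun x => a * mu x + b * mu' x) =
  a * pairing phi mu + b * pairing phi mu'.
Proof.
rewrite /pairing !mulr_sumr -big_split/=; apply: eq_bigr => x _; ring.
Qed.

Lemma pairing_suml (J : Type) (r : seq J) (P : pred J) (lam : J -> R)
    (phi : J -> X -> R) (mu : X -> R) :
  pairing (fun x => \sum_(j <- r | P j) lam j * phi j x) mu =
  \sum_(j <- r | P j) lam j * pairing (phi j) mu.
Proof.
rewrite /pairing; under eq_bigr do rewrite mulr_suml.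
rewrite exchange_big/=; apply: eq_bigr => j _; rewrite mulr_sumr.
by apply: eq_bigr => x _; rewrite mulrA.
Qed.

Lemma constraint_convex_measure c k e mu mu' s : 0 <= s <= 1 ->
  (forall x, 0 <= mu x) -> (forall x, 0 <= mu' x) ->
  (1 - s) * constraint c k e mu + s * constraint c k e mu' <=
  constraint c k e (fun x => (1 - s) * mu x + s * mu' x).
Proof.
move=> s01 mu_ge0 mu'_ge0; rewrite /constraint pairing_comb.
have := hamiltonian_concave HL Q0 (c (k + e)%N) s01 mu_ge0 mu'_ge0.
lra.
Qed.

Lemma constraint_convex_potential (J : finType) (lam : J -> R)
    (c : J -> nat -> X -> R) k e mu :
  (forall j, 0 <= lam j) -> \sum_j lam j = 1 -> (forall x, 0 <= mu x) ->
  constraint (fun k x => \sum_j lam j * c j k x) k e mu <=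
  \sum_j lam j * constraint (c j) k e mu.
Proof.
move=> lam0 lam1 mu_ge0; rewrite /constraint.
under [leRHS]eq_bigr do rewrite mulrDr.
rewrite big_split/= lerD//; last exact: hamiltonian_jensen.
under [leRHS]eq_bigr do rewrite mulrCA.
rewrite -mulr_sumr -pairing_suml ler_wpM2l//.
rewrite le_eqVlt; apply/orP; left; apply/eqP; apply: eq_bigr => x _.
by congr (_ * _); rewrite -sumrB; apply: eq_bigr => j _; rewrite mulrBr.
Qed.

Lemma objective_suml (J : finType) (lam : J -> R) (c : J -> nat -> X -> R) :
  objective (fun k x => \sum_j lam j * c j k x) = \sum_j lam j * objective (c j).
Proof.
rewrite /objective !pairing_suml -sumrB.
by apply: eq_bigr => j _; rewrite mulrBr.
Qed.

Definition atom k e mu : weights R (nat * bool * X)%type :=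
  fun i => if (i.1 == (k, e)) then mu i.2 else 0.

Lemma is_prob_le1 (mu : X -> R) x : is_prob mu -> mu x <= 1.
Proof.
move=> [mu_ge0 <-]; rewrite (bigD1 x)//= lerDl sumr_ge0// => y _; exact: mu_ge0.
Qed.

Lemma sum_atom k e (F : nat -> bool -> R) : (k < n)%N ->
  (forall k' e', (k', e') != (k, e) -> F k' e' = 0) ->
  \sum_(k' < n) \sum_(e' : bool) F k' e' = F k e.
Proof.
move=> kn F0; rewrite (bigD1 (Ordinal kn))//= [X in _ + X]big1 ?addr0; last first.
  move=> k' k'k; rewrite big1// => e' _; apply: F0.
  by apply: contra k'k => /eqP[kk _]; apply/eqP/val_inj.
rewrite (bigD1 e)//= [X in _ + X]big1 ?addr0// => e' e'e; apply: F0.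
by apply: contra e'e => /eqP[->].
Qed.

Lemma atom_simplex k e mu : (k < n)%N -> is_prob mu -> simplex (atom k e mu).
Proof.
move=> kn pmu; split.
  move=> i; rewrite /atom /= in_itv/=; case: ifP => _; last by rewrite lexx ler01.
  by rewrite is_prob_le1// andbT; case: pmu.
rewrite (sum_atom (k := k) (e := e) (F := fun k' e' => \sum_x atom k e mu (k', e', x)))//.
  by case: pmu => _ <-; apply: eq_bigr => x _; rewrite /atom eqxx.
by move=> k' e' /negbTE h; rewrite big1// => x _; rewrite /atom /= h.
Qed.

(** The empty slices do not contribute because the mean vanishes at the origin. *)
Lemma lagrangian_atom c k e mu : (k < n)%N ->
  lagrangian c (atom k e mu) = objective c - constraint c k e mu.
Proof.
move=> kn; rewrite /lagrangian; congr (_ - _).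
rewrite (sum_atom (k := k) (e := e)
  (F := fun k' e' => constraint c k' e' (slice (atom k e mu) k' e')))//.
  by rewrite /slice /atom/= eqxx.
move=> k' e' /negbTE h; rewrite /slice /atom/= h /constraint /pairing.
rewrite big1 ?mulr0 ?add0r; last by move=> x _; rewrite mulr0.
rewrite /hamiltonian /sqnorm big1 ?mulr0// => x _; rewrite big1// => y _.
by rewrite !mul0r (mean00 HL) mulr0.
Qed.

Lemma pairing_shift (phi mu : X -> R) (a : R) : is_prob mu ->
  pairing (fun x => phi x - a) mu = pairing phi mu - a.
Proof.
move=> [_ mu1']; rewrite /pairing.
under eq_bigr do rewrite mulrBl.
by rewrite sumrB -mulr_sumr mu1' mulr1.
Qed.

(** Subtracting a constant in space that is linear in time trades the value of
the constraints against the objective. *)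
Lemma exists_discrete_HJ c (D : R) :
  (forall m, simplex m -> D <= lagrangian c m) ->
  exists c', discrete_HJ c' /\ objective c' = D.
Proof.
move=> cD; pose s : R := (objective c - D) / n%:R.
have ns : n%:R * s = objective c - D.
  by rewrite /s mulrC mulfVK// pnatr_eq0 -lt0n.
exists (fun k x => c k x - k%:R * s); split.
  move=> k e mu kn pmu; have := cD _ (atom_simplex e kn pmu).
  rewrite lagrangian_atom// /constraint hamiltonian_shift.
  have -> : (fun x => c k.+1 x - k.+1%:R * s - (c k x - k%:R * s)) =
      (fun x => (c k.+1 x - c k x) - s).
    by apply/funext => x; rewrite -natr1; ring.
  by rewrite pairing_shift// mulrBr ns; lra.
by rewrite /objective !pairing_shift// ns mul0r subr0 /objective; ring.
Qed.

End Discrete.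

Section ClosedMean.
Context {R : realType} {X : finType}.
Variables (Q : X -> X -> R) (Lam : R -> R -> R).
Hypothesis HL : admissible_mean Lam.
Hypothesis Q0 : forall x y, 0 <= Q x y.
Variables (mu0 mu1 : X -> R).
Hypotheses (Hmu0 : is_prob mu0) (Hmu1 : is_prob mu1).
Variable n : nat.
Hypothesis n_gt0 : (0 < n)%N.

(** The Lagrangian has to be continuous on the whole space of weights, not only on
the simplex; this mean agrees with [Lam] where the simplex lies. *)
Definition closed_mean (s t : R) : R := Lam (Num.max s 0) (Num.max t 0).

Lemma lagrangian_closed c m : simplex n m ->
  lagrangian Q closed_mean mu0 mu1 n c m = lagrangian Q Lam mu0 mu1 n c m.
Proof.
move=> Zm; rewrite /lagrangian; congr (_ - _); apply: eq_bigr => k _.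
apply: eq_bigr => e _; rewrite /constraint; congr (_ + _).
rewrite /hamiltonian /sqnorm; do 2 congr (_ * _).
apply: eq_bigr => x _; apply: eq_bigr => y _; congr (_ * _); rewrite /closed_mean.
by rewrite !(elimT max_idPl) ?mulr_ge0 ?(slice_ge0 _ _ _ Zm).
Qed.

Lemma lagrangian_continuous c :
  continuous (lagrangian Q closed_mean mu0 mu1 n c).
Proof.
have cproj i : continuous (fun m : weights R (nat * bool * X)%type => m i).
  exact: (@proj_continuous _ (fun _ => R)).
apply: continuous_cstB; apply: continuous_sum => k _.
apply: continuous_sum => e _; apply: continuous_add.
  apply: continuous_mull; apply: continuous_sum => x _.
  by apply: continuous_mull; exact: cproj.
do 2 apply: continuous_mull.
apply: continuous_sum => x _; apply: continuous_sum => y _.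
apply: continuous_mull.
apply: (continuous_comp2 (h := fun p : R * R => closed_mean p.1 p.2)
  (f := fun m => slice m k e x * Q x y) (g := fun m => slice m k e y * Q y x)).
- by apply: continuous_mulr; exact: cproj.
- by apply: continuous_mulr; exact: cproj.
- exact: mean_continuous.
Qed.

(** The Lagrangian is convex in [m] and concave in [c]. A potential whose
Lagrangian stayed above [D'] on the whole simplex would yield a discrete
subsolution of value [D'], by testing at the atoms, so the minimax theorem
applies with the bound [D']. *)
Lemma discrete_minimax (D D' : R) : D < D' ->
  (forall c, discrete_HJ Q Lam n c -> objective mu0 mu1 n c <= D) ->
  exists m, simplex n m /\ forall c, lagrangian Q Lam mu0 mu1 n c m <= D'.
Proof.
move=> DD' cD.
pose comb (s : R) (m m' : weights R (nat * bool * X)%type) :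
  weights R (nat * bool * X)%type := fun i => (1 - s) * m i + s * m' i.
have Z0 : @simplex R X n !=set0.
  by exists (atom 0 false mu0); exact: atom_simplex.
have Zcomb s m m' : 0 <= s <= 1 -> simplex n m -> simplex n m' ->
    simplex n (comb s m m').
  move=> /andP[s0 s1] [m01 m1] [m'01 m'1]; split.
    move=> i; have := m01 i; have := m'01 i; rewrite /comb /= !in_itv/=; nra.
  rewrite /comb; under eq_bigr do under eq_bigr do rewrite big_split -!mulr_sumr/=.
  under eq_bigr do rewrite big_split -!mulr_sumr/=.
  by rewrite big_split -!mulr_sumr/= m1 m'1; lra.
have [||||m [Zm mD]] := minimax (@simplex_compact _ _ n) Z0 Zcomb
  (f := fun c m => lagrangian Q closed_mean mu0 mu1 n c m) (D := D').
- exact: lagrangian_continuous.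
- move=> c s m m' s01 Zm Zm'.
  have Zs := Zcomb _ _ _ s01 Zm Zm'.
  rewrite !lagrangian_closed// /lagrangian.
  rewrite (_ : (1 - s) * _ + s * _ = objective mu0 mu1 n c -
     \sum_(k < n) \sum_(e : bool)
       ((1 - s) * constraint Q Lam n c k e (slice m k e) +
        s * constraint Q Lam n c k e (slice m' k e))); last first.
    have lin (A B : 'I_n -> bool -> R) :
        \sum_(k < n) \sum_(e : bool) ((1 - s) * A k e + s * B k e) =
        (1 - s) * \sum_(k < n) \sum_(e : bool) A k e +
        s * \sum_(k < n) \sum_(e : bool) B k e.
      rewrite !mulr_sumr -big_split/=; apply: eq_bigr => k _.
      by rewrite !mulr_sumr -big_split.
    by rewrite lin; ring.
  rewrite lerD2l lerN2 ler_sum// => k _; rewrite ler_sum// => e _.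
  by apply: (constraint_convex_measure HL Q0) => // x;
    [exact: slice_ge0 Zm|exact: slice_ge0 Zm'].
- move=> J c lam lam0 lam1.
  exists (fun k x => \sum_j lam j * c j k x) => m Zm.
  under eq_bigr do rewrite lagrangian_closed//.
  rewrite lagrangian_closed// /lagrangian objective_suml.
  under eq_bigr do rewrite mulrBr mulr_sumr.
  rewrite sumrB lerD2l lerN2 [leRHS]exchange_big/= ler_sum// => k _.
  under [leRHS]eq_bigr do rewrite mulr_sumr.
  rewrite [leRHS]exchange_big/= ler_sum// => e _.
  by apply: (constraint_convex_potential HL Q0) => // x; exact: slice_ge0 Zm.
- move=> c; have [//|none] := pselect (exists m, simplex n m /\
    lagrangian Q closed_mean mu0 mu1 n c m < D').
  exfalso; have [|c' [c'HJ c'D]] := @exists_discrete_HJ _ _ Q Lam HL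
      mu0 mu1 Hmu0 Hmu1 n n_gt0 c D'.
    move=> m Zm; rewrite leNgt; apply/negP => mD; apply: none.
    by exists m; rewrite lagrangian_closed.
  by have := cD _ c'HJ; rewrite c'D leNgt DD'.
- by exists m; split => // c; rewrite -lagrangian_closed.
Qed.

End ClosedMean.

(** * Bernstein polynomials *)

Section Bernstein.
Context {R : realType}.
Implicit Types (n k : nat) (c : nat -> R) (t : R).

Definition bern n k : {poly R} := 'C(n, k)%:R *: ('X^k * (1 - 'X) ^+ (n - k)).

Definition bernstein n c : {poly R} := \sum_(k < n.+1) c k *: bern n k.

Lemma bern_small n k : (n < k)%N -> bern n k = 0.
Proof. by move=> nk; rewrite /bern bin_small// scale0r. Qed.

Lemma hornerE_bern n k t : (bern n k).[t] = 'C(n, k)%:R * (t ^+ k * (1 - t) ^+ (n - k)).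
Proof. by rewrite /bern !hornerE. Qed.

Lemma bern_ge0 n k t : 0 <= t <= 1 -> 0 <= (bern n k).[t].
Proof.
by move=> /andP[t0 t1]; rewrite hornerE_bern !mulr_ge0// exprn_ge0// subr_ge0.
Qed.

Lemma bern_gt0 n k t : (k <= n)%N -> 0 < t < 1 -> 0 < (bern n k).[t].
Proof.
move=> kn /andP[t0 t1].
by rewrite hornerE_bern !mulr_gt0 ?ltr0n ?bin_gt0// exprn_gt0// subr_gt0.
Qed.

Lemma horner_bernstein n c t : (bernstein n c).[t] = \sum_(k < n.+1) c k * (bern n k).[t].
Proof. by rewrite /bernstein horner_sum; apply: eq_bigr => k _; rewrite hornerE. Qed.

Lemma bernstein1 n : bernstein n (fun => 1) = 1.
Proof.
have -> : 1 = (1 - 'X + 'X) ^+ n :> {poly R} by rewrite subrK expr1n.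
rewrite /bernstein exprDn; apply: eq_bigr => k _.
by rewrite scale1r /bern scaler_nat mulrC.
Qed.

Lemma sum_bern n t : \sum_(k < n.+1) (bern n k).[t] = 1.
Proof.
have := congr1 (fun p : {poly R} => p.[t]) (bernstein1 n).
by rewrite horner_bernstein hornerC => <-; apply: eq_bigr => k _; rewrite mul1r.
Qed.

Lemma bernstein_at0 n c : (bernstein n c).[0] = c 0%N.
Proof.
rewrite horner_bernstein big_ord_recl big1 ?addr0.
  by rewrite hornerE_bern bin0 expr0 subn0 subr0 expr1n mulr1 mulr1n !mulr1.
by move=> k _; rewrite hornerE_bern lift0 exprS !mul0r !mulr0.
Qed.

Lemma bernstein_at1 n c : (bernstein n c).[1] = c n.
Proof.
rewrite horner_bernstein big_ord_recr big1 ?add0r/=.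
  by rewrite add0r hornerE_bern binn subnn expr0 expr1n mulr1 mulr1n !mulr1.
move=> k _; rewrite hornerE_bern subrr -subnSK//= exprS mul0r !mulr0//.
Qed.

Lemma bern_pascal n k : bern n.+1 k.+1 = (1 - 'X) * bern n k.+1 + 'X * bern n k.
Proof.
have [kn|nk|->] := ltngtP k n.
- rewrite /bern binS natrD scalerDl subSS -!scalerAr; congr (_ *: _ + _ *: _).
    by rewrite -(subnSK kn) (exprS (1 - 'X)) mulrCA.
  by rewrite exprS mulrA.
- by rewrite !bern_small ?mulr0 ?addr0// ltnW.
- rewrite (bern_small (n := n) (k := n.+1))// mulr0 add0r /bern !binn !subnn !scale1r.
  by rewrite exprS !mulr1.
Qed.

Lemma bern_pascal0 n : bern n.+1 0 = (1 - 'X) * bern n 0.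
Proof. by rewrite /bern !bin0 !scale1r !subn0 !expr0 !mul1r exprS. Qed.

Lemma bernsteinS n c :
  bernstein n.+1 c = (1 - 'X) * bernstein n c + 'X * bernstein n (c \o succn).
Proof.
rewrite /bernstein big_ord_recl.
under eq_bigr do rewrite lift0 bern_pascal scalerDr.
rewrite big_split/= bern_pascal0 addrA; congr (_ + _); last first.
  by rewrite mulr_sumr; apply: eq_bigr => k _; rewrite scalerAr.
rewrite big_ord_recr/= (bern_small (n := n) (k := n.+1))// mulr0 scaler0 addr0.
rewrite [in RHS]big_ord_recl mulrDr; congr (_ + _).
  by rewrite scalerAr.
by rewrite mulr_sumr; apply: eq_bigr => k _; rewrite lift0 scalerAr.
Qed.

Lemma bernsteinB n c c' :
  bernstein n (fun k => c k - c' k) = bernstein n c - bernstein n c'.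
Proof. by rewrite /bernstein -sumrB; apply: eq_bigr => k _; rewrite scalerBl. Qed.

Lemma deriv_bernstein n c : (bernstein n.+1 c)^`() =
  n.+1%:R *: bernstein n (fun k => c k.+1 - c k).
Proof.
elim: n c => [|n IH] c.
  have b0 d : bernstein 0 d = (d 0%N)%:P.
    by rewrite /bernstein big_ord1 /bern bin0 !expr0 mulr1 scale1r alg_polyC.
  rewrite scale1r bernsteinS !b0 derivD !derivM !poly.derivE polyCB /=; ring.
rewrite bernsteinS derivD !derivM !IH !poly.derivE.
set d := fun k => c k.+1 - c k.
have dB : bernstein n.+1 d = bernstein n.+1 (c \o succn) - bernstein n.+1 c.
  by rewrite -bernsteinB.
have dS : bernstein n.+1 d = (1 - 'X) * bernstein n d + 'X * bernstein n (d \o succn).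
  exact: bernsteinS.
rewrite -[in RHS]natr1 scalerDl scale1r {1}dS {}dB scalerDr -!scalerAr; ring.
Qed.

(** The polynomial with coefficients zero up to [k] and one after it is, up to the
factor [n + 1], an antiderivative of the Bernstein polynomial [bern n k]. *)
Lemma deriv_bern_tail n k : (k <= n)%N ->
  (bernstein n.+1 (fun j => (k < j)%:R))^`() = n.+1%:R *: bern n k.
Proof.
move=> kn; rewrite deriv_bernstein; congr (_ *: _).
rewrite /bernstein (bigD1 (Ordinal (kn : (k < n.+1)%N)))//=.
rewrite ltnS leqnn ltnn subr0 scale1r big1 ?addr0// => j jk.
rewrite [(k < j.+1)%N]ltnS leq_eqVlt; case: eqP => [kj|_]; last by rewrite subrr scale0r.
by move: jk => /eqP[]; exact/val_inj.
Qed.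

Lemma bern_X n k : k.+1%:R *: bern n.+1 k.+1 = n.+1%:R *: ('X * bern n k).
Proof.
rewrite /bern -scalerAr !scalerA -!natrM mul_bin_diag subSS exprS; congr (_ *: _).
by rewrite mulrA.
Qed.

Lemma bern_oneBX n k : (k <= n)%N ->
  (n.+1 - k)%:R *: bern n.+1 k = n.+1%:R *: ((1 - 'X) * bern n k).
Proof.
move=> kn; rewrite /bern -scalerAr !scalerA -!natrM mul_bin_down.
by rewrite subSn// exprS; congr (_ *: _); ring.
Qed.

Lemma horner_bern_X n k t :
  k.+1%:R * (bern n.+1 k.+1).[t] = n.+1%:R * (t * (bern n k).[t]).
Proof. by rewrite -hornerZ bern_X hornerZ hornerM hornerX. Qed.

Lemma horner_bern_oneBX n k t : (k <= n)%N ->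
  (n.+1 - k)%:R * (bern n.+1 k).[t] = n.+1%:R * ((1 - t) * (bern n k).[t]).
Proof.
by move=> kn; rewrite -hornerZ bern_oneBX// hornerZ hornerM hornerD hornerN hornerX hornerC.
Qed.

End Bernstein.

(** * Discrete flows *)

Section Network.
Context {R : realType} {X : finType}.

(** Fredholm alternative: the columns of the cokernel matrix of [b] lie in its
kernel, and they cut out its row space. *)
Lemma solvable_of_kernel (I : finType) (b : I -> I -> R) (l : I -> R) :
  (forall v : I -> R, (forall i, \sum_j b i j * v j = 0) -> \sum_i l i * v i = 0) ->
  exists c : I -> R, forall j, l j = \sum_i c i * b i j.
Proof.
move=> ker; pose B : 'M[R]_#|I| := \matrix_(i, j) b (enum_val i) (enum_val j).
pose L : 'rV[R]_#|I| := \row_j l (enum_val j).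
have enumE (F : I -> R) : \sum_i F i = \sum_(i < #|I|) F (enum_val i).
  by rewrite (reindex (@enum_val I predT))//; apply: onW_bij; exact: enum_val_bij.
have BE i j : B i j = b (enum_val i) (enum_val j) by rewrite mxE.
have : (L <= B)%MS.
  rewrite submxE; apply/eqP/matrixP => i0 k; rewrite !mxE.
  have kerk := ker (fun i => cokermx B (enum_rank i) k).
  rewrite -[RHS]kerk.
    by rewrite enumE; apply: eq_bigr => j _; rewrite mxE enum_valK.
  move=> i; have /matrixP/(_ (enum_rank i) k) := mulmx_coker B.
  rewrite !mxE => e; rewrite enumE -[RHS]e; apply: eq_bigr => j _.
  by rewrite BE enum_rankK enum_valK.
case/submxP => D LD; exists (fun i => D 0 (enum_rank i)) => j.
have /matrixP/(_ 0 (enum_rank j)) := LD.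
rewrite !mxE enum_rankK => ->; rewrite enumE; apply: eq_bigr => i _.
by rewrite BE enum_valK enum_rankK.
Qed.

Implicit Types (V w : X -> X -> R) (phi mu : X -> R).

Definition divergence V x : R := 2^-1 * \sum_y (V y x - V x y).

Lemma pairing_divergence phi V :
  pairing phi (divergence V) = 2^-1 * \sum_x \sum_y grad phi x y * V x y.
Proof.
rewrite /pairing /divergence.
under eq_bigr do rewrite mulrCA.
rewrite -mulr_sumr; congr (_ * _).
under eq_bigr do rewrite mulr_sumr.
under eq_bigr do under eq_bigr do rewrite mulrBr.
under eq_bigr do rewrite sumrB.
rewrite sumrB exchange_big/= -sumrB; apply: eq_bigr => x _.
by rewrite -sumrB; apply: eq_bigr => y _; rewrite /grad mulrBl.
Qed.

Lemma sum_divergence V : \sum_x divergence V x = 0.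
Proof.
rewrite /divergence -mulr_sumr; under eq_bigr do rewrite sumrB.
by rewrite sumrB exchange_big/= subrr mulr0.
Qed.

Definition energy w phi : R :=
  2^-1 * (2^-1 * \sum_x \sum_y w x y * grad phi x y ^+ 2).

Definition flux w phi x y : R := w x y * grad phi x y.

Lemma pairing_flux w phi : pairing phi (divergence (flux w phi)) = 2 * energy w phi.
Proof.
rewrite pairing_divergence /energy [RHS]mulrA mulfV ?pnatr_eq0// mul1r.
congr (_ * _); apply: eq_bigr => x _; apply: eq_bigr => y _.
by rewrite /flux; ring.
Qed.

(** The weighted Laplacian is symmetric and its quadratic form is the energy.
Hence the gradient of a kernel element vanishes on every edge of positive
weight, and the Fredholm alternative applies. *)
Lemma network_potential w (l : X -> R) : (forall x y, 0 <= w x y) ->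
  (forall v, (forall x y, w x y * grad v x y = 0) -> pairing v l = 0) ->
  exists phi, forall x, l x = divergence (flux w phi) x.
Proof.
move=> w0 ker.
pose delta (i : X) : X -> R := fun x => (x == i)%:R.
have deltaE phi x : \sum_i phi i * delta i x = phi x.
  rewrite (bigD1 x)//= /delta eqxx mulr1 big1 ?addr0// => i /negbTE ix.
  by rewrite eq_sym ix mulr0.
have [|c cE] := @solvable_of_kernel X (fun i j => divergence (flux w (delta i)) j) l;
  last first.
  exists c => j; rewrite cE /divergence.
  under eq_bigr do rewrite mulrCA.
  rewrite -mulr_sumr; congr (_ * _).
  under eq_bigr do rewrite mulr_sumr.
  rewrite exchange_big/=; apply: eq_bigr => y _.
  rewrite /flux /grad -!(deltaE c) -!sumrB !mulr_sumr -sumrB.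
  by apply: eq_bigr => i _; ring.
move=> v kv; have := ker v; rewrite /pairing.
under eq_bigr do rewrite mulrC.
apply.
have : 2^-1 * \sum_x \sum_y w x y * grad v x y ^+ 2 = 0.
  transitivity (\sum_i v i * \sum_j divergence (flux w (delta i)) j * v j); last first.
    by rewrite big1// => i _; rewrite kv mulr0.
  transitivity (\sum_i v i * pairing v (divergence (flux w (delta i)))); last first.
    by apply: eq_bigr => i _; congr (_ * _); apply: eq_bigr => j _; rewrite mulrC.
  under [RHS]eq_bigr do rewrite pairing_divergence mulrCA.
  rewrite -mulr_sumr; congr (_ * _).
  under [RHS]eq_bigr do rewrite mulr_sumr.
  rewrite [RHS]exchange_big/=; apply: eq_bigr => x _.
  under [RHS]eq_bigr do rewrite mulr_sumr.
  rewrite [RHS]exchange_big/=; apply: eq_bigr => y _.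
  rewrite expr2 {2}/grad -!(deltaE v) -sumrB !mulr_sumr.
  by apply: eq_bigr => i _; rewrite /flux {3}/grad; ring.
move/eqP; rewrite mulf_eq0 invr_eq0 pnatr_eq0/= => /eqP s0 x y.
have nneg x' y' : 0 <= w x' y' * grad v x' y' ^+ 2.
  by rewrite mulr_ge0 ?sqr_ge0.
have /eqP := s0; rewrite psumr_eq0; last first.
  by move=> x' _; apply: sumr_ge0 => y' _; exact: nneg.
move=> /allP/(_ x (mem_index_enum _))/=; rewrite psumr_eq0//.
move=> /allP/(_ y (mem_index_enum _))/=.
rewrite expr2 mulrA mulf_eq0 => /orP[/eqP//|/eqP ->].
by rewrite mulr0.
Qed.

End Network.

Section DiscreteFlow.
Context {R : realType} {X : finType}.
Variables (Q : X -> X -> R) (Lam : R -> R -> R).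
Hypothesis HL : admissible_mean Lam.
Hypothesis Q0 : forall x y, 0 <= Q x y.
Variables (mu0 mu1 : X -> R).
Variable n : nat.
Variable m : nat * bool * X -> R.
Hypothesis Zm : simplex n m.

Definition mobility (mu : X -> R) x y : R := Lam (mu x * Q x y) (mu y * Q y x).

(** The index is shifted by one to make room for [mu0] in front: time [j.+1]
belongs to the cell [j]. The factor [n] normalises: along a discrete flow the mass
is conserved, so that every cell carries the share [1 / n] of [m]. *)
Definition state j (x : X) : R :=
  if j is j'.+1 then
    if (j' < n)%N then n%:R * \sum_(e : bool) m (j', e, x) else mu1 x
  else mu0 x.

Definition weight j (e : bool) (x y : X) : R :=
  if j is j'.+1 then
    if (j' < n)%N then mobility (slice m j' e) x y else 0
  else 0.

Lemma hamiltonian_energy c mu : hamiltonian Q Lam c mu = energy (mobility mu) c.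
Proof.
rewrite /hamiltonian /sqnorm /energy; do 2 congr (_ * _).
by apply: eq_bigr => x _; apply: eq_bigr => y _; rewrite mulrC.
Qed.

Lemma energyD (w w' : X -> X -> R) c :
  energy (fun x y => w x y + w' x y) c = energy w c + energy w' c.
Proof.
rewrite /energy -!mulrDr -big_split/=; do 2 congr (_ * _).
apply: eq_bigr => x _; rewrite -big_split; apply: eq_bigr => y _; exact: mulrDl.
Qed.

Lemma energy0 (c : X -> R) : energy (fun _ _ => 0) c = 0.
Proof.
by rewrite /energy big1 ?mulr0// => x _; rewrite big1// => y _; rewrite mul0r.
Qed.

(** The potential at time [k] is tested in the cell that begins there and in the
cell that ends there. *)
Definition step_weight k x y : R := weight k.+1 false x y + weight k true x y.

(** Summation by parts decouples the Lagrangian into one quadratic problem for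
each potential. *)
Lemma lagrangian_decoupled c : lagrangian Q Lam mu0 mu1 n c m =
  \sum_(k < n.+1) (pairing (c k) (fun x => state k.+1 x - state k x) -
                   energy (step_weight k) (c k)).
Proof.
have pairingB (phi mu mu' : X -> R) :
    pairing phi (fun x => mu x - mu' x) = pairing phi mu - pairing phi mu'.
  by rewrite /pairing -sumrB; apply: eq_bigr => x _; rewrite mulrBr.
have pairingBl (phi phi' mu : X -> R) :
    pairing (fun x => phi x - phi' x) mu = pairing phi mu - pairing phi' mu.
  by rewrite /pairing -sumrB; apply: eq_bigr => x _; rewrite mulrBl.
rewrite sumrB.
have -> : \sum_(k < n.+1) pairing (c k) (fun x => state k.+1 x - state k x) =
    (\sum_(k < n) pairing (c k) (state k.+1) + pairing (c n) mu1) -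
    (pairing (c 0%N) mu0 + \sum_(k < n) pairing (c k.+1) (state k.+1)).
  under eq_bigr do rewrite pairingB.
  rewrite sumrB big_ord_recr big_ord_recl/=; congr (_ + pairing _ _ - _).
  by apply/funext => x; rewrite /= ltnn.
have -> : \sum_(k < n.+1) energy (step_weight k) (c k) =
    \sum_(k < n) \sum_(e : bool) hamiltonian Q Lam (c (k + e)%N) (slice m k e).
  under eq_bigr do rewrite energyD.
  rewrite big_split/= big_ord_recr [X in _ + X = _]big_ord_recl/=.
  rewrite (_ : weight n.+1 false = fun _ _ => 0); last first.
    by apply/funext => x; apply/funext => y; rewrite /= ltnn.
  rewrite !energy0 addr0 add0r -big_split/=; apply: eq_bigr => k _.
  rewrite big_bool/= !hamiltonian_energy addn0 addn1.
  rewrite (_ : bump 0 k = k.+1)//.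
  have weightE e : weight k.+1 e = mobility (slice m k e).
    by apply/funext => x; apply/funext => y; rewrite /= ltn_ord.
  by rewrite !weightE addrC.
have step : \sum_(k < n) \sum_(e : bool)
      n%:R * pairing (fun x => c k.+1 x - c k x) (slice m k e) =
    \sum_(k < n) pairing (c k.+1) (state k.+1) -
    \sum_(k < n) pairing (c k) (state k.+1).
  rewrite -sumrB; apply: eq_bigr => k _; rewrite -pairingBl /pairing.
  rewrite -mulr_sumr exchange_big/= mulr_sumr; apply: eq_bigr => x _.
  by rewrite ltn_ord -mulr_sumr mulrCA.
rewrite /lagrangian /objective /constraint.
under eq_bigr do rewrite big_split/=.
rewrite big_split/= step; lra.
Qed.

Lemma mobility_ge0 mu x y : (forall x, 0 <= mu x) -> 0 <= mobility mu x y.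
Proof. by move=> mu_ge0; rewrite (mean_ge0 HL)// mulr_ge0. Qed.

Lemma weight_ge0 j e x y : 0 <= weight j e x y.
Proof.
case: j => [//|j] /=; case: ifP => // _.
by apply: mobility_ge0 => z; exact: slice_ge0 Zm.
Qed.

(** Superadditivity of the mean: the two weights at a time coexist inside the
mobility of the state at that time. *)
Lemma weight_state j x y : (0 < j <= n)%N ->
  n%:R * (weight j false x y + weight j true x y) <= mobility (state j) x y.
Proof.
case: j => // j /= jn; rewrite jn /mobility /= jn.
rewrite -!mulrA (mean_homogeneous HL)//; last 2 first.
- by rewrite mulr_ge0// sumr_ge0// => e _; exact: (slice_ge0 j e x Zm).
- by rewrite mulr_ge0// sumr_ge0// => e _; exact: (slice_ge0 j e y Zm).
rewrite ler_wpM2l// !big_bool/= !mulrDl addrC.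
by apply: (mean_superadditive HL); rewrite mulr_ge0//; exact: (slice_ge0 _ _ _ Zm).
Qed.

(** Each decoupled problem is a concave quadratic function of one potential. Being
bounded above, its linear part vanishes on the kernel of the energy, so that
its Euler-Lagrange equation is solvable; the value at a solution is the energy. *)
Lemma discrete_flow (D : R) :
  (forall c, lagrangian Q Lam mu0 mu1 n c m <= D) ->
  exists c : nat -> X -> R,
    (forall k x, (k <= n)%N ->
      state k.+1 x - state k x = divergence (flux (step_weight k) (c k)) x) /\
    \sum_(k < n.+1) energy (step_weight k) (c k) <= D.
Proof.
move=> LD.
have pot k : exists phi, (k <= n)%N -> forall x,
    state k.+1 x - state k x = divergence (flux (step_weight k) phi) x.
  have [kn|_] := leqP k n; last by exists (fun=> 0).
  have [] := @network_potential R X (step_weight k) (fun x => state k.+1 x - state k x).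
  - by move=> x y; rewrite addr_ge0// weight_ge0.
  - move=> v kv; set P := pairing _ _; apply/eqP; apply: contraT => P0.
    pose s := (D + 1) / P.
    have := LD (fun j x => if j == k then s * v x else 0).
    rewrite lagrangian_decoupled.
    rewrite (bigD1 (Ordinal (kn : (k < n.+1)%N)))//= eqxx big1 ?addr0; last first.
      move=> j jk; rewrite (_ : (nat_of_ord j == k) = false); last first.
        by apply/negbTE; apply: contra jk => /eqP jk; apply/eqP/val_inj.
      rewrite /pairing big1; last by move=> x _; rewrite mul0r.
      rewrite sub0r /energy big1 ?mulr0 ?oppr0// => x _; rewrite big1// => y _.
      by rewrite /grad subrr expr0n/= mulr0.
    rewrite (_ : energy _ _ = 0) ?subr0; last first.
      rewrite /energy big1 ?mulr0// => x _; rewrite big1// => y _.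
      rewrite /grad -mulrBr exprMn mulrCA -/(grad v x y) (expr2 (grad v x y)).
      by rewrite (mulrA (step_weight k x y)) kv mul0r mulr0.
    rewrite (_ : pairing _ _ = s * P); last first.
      by rewrite /P /pairing mulr_sumr; apply: eq_bigr => x _; rewrite mulrA.
    by rewrite /s mulfVK//; lra.
  - by move=> phi phiE; exists phi.
have [c cE] := choice pot; exists c; split; first by move=> k x kn; exact: cE.
have := LD c; rewrite lagrangian_decoupled; apply: le_trans.
rewrite ler_sum// => k _.
rewrite (_ : (fun x => _) = divergence (flux (step_weight k) (c k))); last first.
  by apply/funext => x; rewrite cE// -ltnS.
by rewrite pairing_flux; lra.
Qed.

End DiscreteFlow.

(** * Bernstein curves of measures *)

Section PolynomialFlow.
Context {R : realType} {X : finType}.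
Variables (Q : X -> X -> R) (Lam : R -> R -> R).
Hypothesis HL : admissible_mean Lam.
Hypothesis Q0 : forall x y, 0 <= Q x y.
Hypothesis Qsupp : forall x y, Q x y = 0 -> Q y x = 0.

(** A solution of the continuity equation that is polynomial in time; [T x y] is
an antiderivative of a bound for the action density on the edge [x y]. *)
Record polynomial_flow (mu0 mu1 : X -> R) (P : X -> {poly R})
    (W T : X -> X -> {poly R}) : Prop := PolynomialFlow {
  pf_prob : forall t, 0 <= t <= 1 -> is_prob (fun x => (P x).[t]) ;
  pf_start : forall x, (P x).[0] = mu0 x ;
  pf_end : forall x, (P x).[1] = mu1 x ;
  pf_ce : forall x t, (P x)^`().[t] = divergence (fun x y => (W x y).[t]) x ;
  pf_edge : forall x y t, Q x y = 0 -> (W x y).[t] = 0 ;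
  pf_cost_ge0 : forall x y t, 0 <= t <= 1 -> 0 <= (T x y)^`().[t] ;
  pf_cost : forall x y t, 0 <= t <= 1 ->
    (W x y).[t] ^+ 2 <= mobility Q Lam (fun x => (P x).[t]) x y * (T x y)^`().[t]
}.

(** The control points [st j] of the curve are joined by gradient fluxes with two
weights: the step from [i] to [i + 1] uses the weight [al] at its right end and
the weight [be] at its left end, and both weights at [j] fit together into the
mobility of [st j]. Each weight vanishes near its end of the sequence, as far as
the ratio of neighbouring indices, counted from that end, exceeds [C]. *)
Variables (M : nat) (st : nat -> X -> R) (al be f : nat -> X -> X -> R).
Variables (C r : R).
Let N := M.+2.
Hypothesis st_prob : forall j, is_prob (st j).
Hypothesis al_ge0 : forall j x y, 0 <= al j x y.
Hypothesis be_ge0 : forall j x y, 0 <= be j x y.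
Hypothesis C_ge0 : 0 <= C.
Hypothesis r_gt0 : 0 < r.
Hypothesis al_be_le : forall j x y, (j <= N)%N ->
  r * (al j x y + be j x y) <= mobility Q Lam (st j) x y.
Hypothesis al_cushion : forall i x y, (i < N)%N ->
  al i.+1 x y = 0 \/ ((0 < i)%N /\ i.+1%:R <= C * i%:R).
Hypothesis be_cushion : forall i x y, (i < N)%N ->
  be i x y = 0 \/ ((i <= M)%N /\ (N - i)%:R <= C * (M.+1 - i)%:R).

Definition step_flux i x y : R := (al i.+1 x y + be i x y) * f i x y.

Hypothesis st_step : forall i x, (i < N)%N ->
  st i.+1 x - st i x = divergence (step_flux i) x.

Definition bernstein_mass x : {poly R} := bernstein N (fun j => st j x).

Definition bernstein_flux x y : {poly R} :=
  N%:R *: bernstein M.+1 (fun i => step_flux i x y).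

Definition bernstein_cost x y : {poly R} :=
  \sum_(i < N) ((N%:R * C / r * al i.+1 x y * f i x y ^+ 2) *:
                  bernstein M.+1 (fun j => (i.-1 < j)%N%:R) +
                (N%:R * C / r * be i x y * f i x y ^+ 2) *:
                  bernstein M.+1 (fun j => (i < j)%N%:R)).

(** Neighbouring Bernstein polynomials of the degrees [N] and [M] multiply to the
square of the one in between, up to a rational factor. *)
Lemma bern_sqr_left i t : (0 < i)%N ->
  i.+1%:R * (bern N i.+1).[t] * (M.+1%:R * (bern M i.-1).[t]) =
  N%:R * i%:R * (bern M.+1 i).[t] ^+ 2 :> R.
Proof.
case: i => // i _ /=.
have e := horner_bern_X M i t; rewrite horner_bern_X.
have -> : N%:R * (t * (bern M.+1 i.+1).[t]) * (M.+1%:R * (bern M i).[t]) =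
  N%:R * (bern M.+1 i.+1).[t] * (M.+1%:R * (t * (bern M i).[t])) by ring.
by rewrite -e; ring.
Qed.

Lemma bern_sqr_right i t : (i <= M)%N ->
  (N - i)%:R * (bern N i).[t] * (M.+1%:R * (bern M i).[t]) =
  N%:R * (M.+1 - i)%:R * (bern M.+1 i).[t] ^+ 2 :> R.
Proof.
move=> iM.
have e := horner_bern_oneBX t iM; rewrite (horner_bern_oneBX _ (leqW iM)).
have -> : N%:R * ((1 - t) * (bern M.+1 i).[t]) * (M.+1%:R * (bern M i).[t]) =
  N%:R * (bern M.+1 i).[t] * (M.+1%:R * ((1 - t) * (bern M i).[t])) by ring.
by rewrite -e; ring.
Qed.

Lemma horner_bernstein_cost x y t : (bernstein_cost x y)^`().[t] =
  \sum_(i < N) (M.+1%:R * (N%:R * C / r * al i.+1 x y * f i x y ^+ 2) *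
                  (bern M i.-1).[t]) +
  \sum_(i < N) (M.+1%:R * (N%:R * C / r * be i x y * f i x y ^+ 2) *
                  (bern M i).[t]).
Proof.
rewrite /bernstein_cost (raddf_sum (@deriv R)) horner_sum -big_split; apply: eq_bigr => i _ /=.
rewrite derivD !derivZ deriv_bern_tail; last first.
  by case: (nat_of_ord i) (ltn_ord i).
have [be0|[iM _]] := be_cushion x y (ltn_ord i).
  by rewrite be0 !(mulr0,mul0r) scale0r addr0 addr0 !hornerZ; ring.
by rewrite deriv_bern_tail// hornerD !hornerZ; ring.
Qed.

Lemma no_edge j x y : (j <= N)%N -> Q x y = 0 -> al j x y = 0 /\ be j x y = 0.
Proof.
move=> jN Qxy; have := al_be_le x y jN.
rewrite /mobility Qxy (Qsupp Qxy) !mulr0 (mean00 HL) pmulr_rle0//.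
by have := al_ge0 j x y; have := be_ge0 j x y; lra.
Qed.

Lemma bernstein_mass_prob t : 0 <= t <= 1 -> is_prob (fun x => (bernstein_mass x).[t]).
Proof.
move=> t01; split.
  move=> x; rewrite horner_bernstein sumr_ge0// => k _.
  by rewrite mulr_ge0 ?bern_ge0//; case: (st_prob k).
under eq_bigr do rewrite horner_bernstein.
rewrite exchange_big/= -[RHS](sum_bern N t); apply: eq_bigr => k _.
by rewrite -mulr_suml; case: (st_prob k) => _ ->; rewrite mul1r.
Qed.

(** The Cauchy-Schwarz hypothesis for one step: the mobility grows like the
Bernstein polynomial of degree [N] at [i + 1], the flux like the one of degree
[M + 1] at [i], and the cost density is chosen as their squared quotient. By
[bern_sqr_left] this quotient is a Bernstein polynomial of degree [M] times
[(i + 1) / i], which is at most [C] outside the cushion. *)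
Lemma left_term i x y t : (i < N)%N -> 0 <= t <= 1 ->
  (N%:R * (bern M.+1 i).[t] * (al i.+1 x y * f i x y)) ^+ 2 <=
  (r * (bern N i.+1).[t] * al i.+1 x y) *
  (M.+1%:R * (N%:R * C / r * al i.+1 x y * f i x y ^+ 2) * (bern M i.-1).[t]).
Proof.
move=> iN t01; have [->|[i0 iC]] := al_cushion x y iN.
  by rewrite !(mulr0, mul0r) expr0n.
set a := al _ _ _; set g := f _ _ _.
have -> : r * (bern N i.+1).[t] * a * (M.+1%:R * (N%:R * C / r * a * g ^+ 2) *
    (bern M i.-1).[t]) = (r / r) * (N%:R * a ^+ 2 * g ^+ 2) *
    (C * ((bern N i.+1).[t] * (M.+1%:R * (bern M i.-1).[t]))) by ring.
rewrite divff ?gt_eqF// mul1r.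
have -> : (N%:R * (bern M.+1 i).[t] * (a * g)) ^+ 2 =
  (N%:R * a ^+ 2 * g ^+ 2) * (N%:R * (bern M.+1 i).[t] ^+ 2) by ring.
apply: ler_wpM2l; first by apply: mulr_ge0 (sqr_ge0 _); apply: mulr_ge0 (sqr_ge0 _).
rewrite -(@ler_pM2l _ i.+1%:R)//.
rewrite [leRHS]mulrCA [X in _ <= C * X]mulrA bern_sqr_left//.
have -> : C * (N%:R * i%:R * (bern M.+1 i).[t] ^+ 2) =
  (C * i%:R) * (N%:R * (bern M.+1 i).[t] ^+ 2) by ring.
by rewrite ler_wpM2r// mulr_ge0 ?sqr_ge0.
Qed.

Lemma right_term i x y t : (i < N)%N -> 0 <= t <= 1 ->
  (N%:R * (bern M.+1 i).[t] * (be i x y * f i x y)) ^+ 2 <=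
  (r * (bern N i).[t] * be i x y) *
  (M.+1%:R * (N%:R * C / r * be i x y * f i x y ^+ 2) * (bern M i).[t]).
Proof.
move=> iN t01; have [->|[iM iC]] := be_cushion x y iN.
  by rewrite !(mulr0, mul0r) expr0n.
set a := be _ _ _; set g := f _ _ _.
have -> : r * (bern N i).[t] * a * (M.+1%:R * (N%:R * C / r * a * g ^+ 2) *
    (bern M i).[t]) = (r / r) * (N%:R * a ^+ 2 * g ^+ 2) *
    (C * ((bern N i).[t] * (M.+1%:R * (bern M i).[t]))) by ring.
rewrite divff ?gt_eqF// mul1r.
have -> : (N%:R * (bern M.+1 i).[t] * (a * g)) ^+ 2 =
  (N%:R * a ^+ 2 * g ^+ 2) * (N%:R * (bern M.+1 i).[t] ^+ 2) by ring.
apply: ler_wpM2l; first by apply: mulr_ge0 (sqr_ge0 _); apply: mulr_ge0 (sqr_ge0 _).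
rewrite -(@ler_pM2l _ (N - i)%:R) ?ltr0n ?subn_gt0//.
rewrite [leRHS]mulrCA [X in _ <= C * X]mulrA bern_sqr_right//.
have -> : C * (N%:R * (M.+1 - i)%:R * (bern M.+1 i).[t] ^+ 2) =
  (C * (M.+1 - i)%:R) * (N%:R * (bern M.+1 i).[t] ^+ 2) by ring.
by rewrite ler_wpM2r// mulr_ge0 ?sqr_ge0.
Qed.

(** Here the superadditivity of the mean transfers the mobility from the control
points to the curve. *)
Lemma weights_le_mobility x y t : 0 <= t <= 1 ->
  \sum_(i < N) r * (bern N i.+1).[t] * al i.+1 x y +
  \sum_(i < N) r * (bern N i).[t] * be i x y <=
  mobility Q Lam (fun x => (bernstein_mass x).[t]) x y.
Proof.
move=> t01.
apply: (@le_trans _ _ (\sum_(j < N.+1) (bern N j).[t] * mobility Q Lam (st j) x y)).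
  apply: (@le_trans _ _ (\sum_(j < N.+1) (bern N j).[t] * (r * (al j x y + be j x y)))).
    under [leRHS]eq_bigr do rewrite mulrDr mulrDr.
    rewrite big_split/= lerD//.
      rewrite [leRHS]big_ord_recl/= -[leLHS]add0r lerD//.
        by rewrite !mulr_ge0 ?bern_ge0// ltW.
      by rewrite le_eqVlt; apply/orP; left; apply/eqP/eq_bigr => i _; ring.
    rewrite [leRHS]big_ord_recr/= -[leLHS]addr0 lerD//.
      by rewrite le_eqVlt; apply/orP; left; apply/eqP/eq_bigr => i _; ring.
    by rewrite !mulr_ge0 ?bern_ge0// ltW.
  by rewrite ler_sum// => j _; rewrite ler_wpM2l ?bern_ge0// al_be_le// -ltnS.
rewrite /mobility !horner_bernstein !mulr_suml.
have e z w : \sum_(k < N.+1) st k z * (bern N k).[t] * Q z w =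
    \sum_(k < N.+1) (bern N k).[t] * (st k z * Q z w).
  by apply: eq_bigr => k _; ring.
rewrite !e; apply: (mean_sum HL) => j _; rewrite ?bern_ge0//.
  by rewrite mulr_ge0//; case: (st_prob j).
by rewrite mulr_ge0//; case: (st_prob j).
Qed.

Lemma NCr_ge0 : 0 <= N%:R * C / r.
Proof. by rewrite divr_ge0 ?mulr_ge0// ltW. Qed.

Lemma cost_coef_ge0 (w g : R) : 0 <= w -> 0 <= N%:R * C / r * w * g ^+ 2.
Proof. by move=> w0; apply: mulr_ge0 (sqr_ge0 g); apply: mulr_ge0 NCr_ge0 w0. Qed.

Lemma bernstein_polynomial_flow : polynomial_flow (st 0%N) (st N)
  bernstein_mass bernstein_flux bernstein_cost.
Proof.
have lt0 i x y t : 0 <= t <= 1 -> 0 <= M.+1%:R *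
    (N%:R * C / r * al i.+1 x y * f i x y ^+ 2) * (bern M i.-1).[t].
  by move=> t01; apply: mulr_ge0 (bern_ge0 _ _ t01); rewrite mulr_ge0// cost_coef_ge0.
have rt0 i x y t : 0 <= t <= 1 -> 0 <= M.+1%:R *
    (N%:R * C / r * be i x y * f i x y ^+ 2) * (bern M i).[t].
  by move=> t01; apply: mulr_ge0 (bern_ge0 _ _ t01); rewrite mulr_ge0// cost_coef_ge0.
split.
- exact: bernstein_mass_prob.
- by move=> x; rewrite bernstein_at0.
- by move=> x; rewrite bernstein_at1.
- move=> x t; rewrite /bernstein_mass deriv_bernstein hornerZ horner_bernstein.
  rewrite /divergence /bernstein_flux.
  under [X in _ = _ * X]eq_bigr do rewrite !hornerZ !horner_bernstein -mulrBr -sumrB.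
  rewrite -mulr_sumr mulrCA; congr (_ * _); rewrite exchange_big/= mulr_sumr.
  apply: eq_bigr => k _; rewrite (st_step _ (ltn_ord k)) /divergence -mulrA.
  by congr (_ * _); rewrite mulr_suml; apply: eq_bigr => y _; rewrite mulrBl.
- move=> x y t Qxy; rewrite /bernstein_flux hornerZ horner_bernstein big1 ?mulr0// => k _.
  have [a0 _] := no_edge (ltn_ord k : (k.+1 <= N)%N) Qxy.
  have [_ b0] := no_edge (ltnW (ltn_ord k)) Qxy.
  by rewrite /step_flux a0 b0 addr0 !mul0r.
- move=> x y t t01; rewrite horner_bernstein_cost addr_ge0// sumr_ge0// => i _.
  + exact: lt0.
  + exact: rt0.
- move=> x y t t01; rewrite horner_bernstein_cost.
  apply: le_trans (ler_wpM2r _ (weights_le_mobility x y t01)); last first.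
    by rewrite addr_ge0// sumr_ge0// => i _; [exact: lt0|exact: rt0].
  rewrite /bernstein_flux hornerZ horner_bernstein mulr_sumr.
  rewrite (_ : \sum_(i < N) _ =
      \sum_(i < N) N%:R * (bern M.+1 i).[t] * (al i.+1 x y * f i x y) +
      \sum_(i < N) N%:R * (bern M.+1 i).[t] * (be i x y * f i x y)); last first.
    by rewrite -big_split; apply: eq_bigr => i _; rewrite /step_flux/=; ring.
  apply: cauchy_schwarz2.
  + by rewrite sumr_ge0// => i _; rewrite !mulr_ge0 ?bern_ge0// ltW.
  + by rewrite sumr_ge0// => i _; exact: lt0.
  + by rewrite sumr_ge0// => i _; rewrite !mulr_ge0 ?bern_ge0// ltW.
  + by rewrite sumr_ge0// => i _; exact: rt0.
  + apply: cauchy_schwarz_sum => i _.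
    * by rewrite !mulr_ge0 ?bern_ge0// ltW.
    * exact: lt0.
    * exact: left_term.
  + apply: cauchy_schwarz_sum => i _.
    * by rewrite !mulr_ge0 ?bern_ge0// ltW.
    * exact: rt0.
    * exact: right_term.
Qed.

Lemma bernstein_cost_le x y : (bernstein_cost x y).[1] - (bernstein_cost x y).[0] <=
  N%:R * C / r * \sum_(i < N) (al i.+1 x y + be i x y) * f i x y ^+ 2.
Proof.
rewrite /bernstein_cost !horner_sum -sumrB mulr_sumr ler_sum// => i _.
rewrite !hornerD !hornerZ !bernstein_at1 !bernstein_at0 ltn0 !mulr0 add0r subr0.
rewrite [leRHS]mulrA [X in _ <= X * _]mulrDr [leRHS]mulrDl lerD//.
  by rewrite ler_piMr ?lern1 ?leq_b1// cost_coef_ge0.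
by rewrite ler_piMr ?lern1 ?leq_b1// cost_coef_ge0.
Qed.

End PolynomialFlow.

(** * Polynomial curves in time and dual interpolation *)

(** The integral of a nonnegative function is a supremum over the simple functions
below it, hence monotone even for functions that are not measurable. *)
Lemma ge0_le_integral_nonmeasurable d (T : measurableType d) (R : realType)
    (mu : {measure set T -> \bar R}) (D : set T) (f g : T -> \bar R) :
  (forall x, D x -> (0 <= f x)%E) -> (forall x, D x -> (f x <= g x)%E) ->
  (\int[mu]_(x in D) f x <= \int[mu]_(x in D) g x)%E.
Proof.
move=> f0 fg; rewrite !ge0_integralE//; last first.
  by move=> x Dx; exact: le_trans (f0 x Dx) (fg x Dx).
apply: le_ereal_sup => _ [h hf <-]; exists h => // x.
by apply: le_trans (hf x) _; rewrite !patchE; case: ifPn => // /set_mem; exact: fg.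
Qed.

Section PolynomialsInTime.
Context {R : realType}.
Local Notation leb := (@lebesgue_measure R).
Implicit Types (p q : {poly R}) (f : R -> R).

Lemma continuous_horner_within p (A : set R) : {within A, continuous (horner p)}.
Proof. by apply: continuous_subspaceT => x; exact: continuous_horner. Qed.

Lemma derivable_oo_horner p (a b : R) : derivable_oo_LRcontinuous (horner p) a b.
Proof.
split; first by move=> t _; exact: derivable_horner.
- by apply: cvg_at_right_filter; exact: continuous_horner.
- by apply: cvg_at_left_filter; exact: continuous_horner.
Qed.

Lemma integrable_cc_oo f : leb.-integrable `[0, 1] (EFin \o f) ->
  leb.-integrable `]0, 1[ (EFin \o f).
Proof. by apply: integrableS => //; exact: subset_itv_oo_cc. Qed.

Lemma Rintegral_oo_cc f : leb.-integrable `[0, 1] (EFin \o f) ->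
  \int[leb]_(t in `]0, 1[) f t = \int[leb]_(t in `[0, 1]) f t.
Proof.
move=> fi; rewrite Rintegral_itv_bndo_bndc; last exact: integrable_cc_oo.
rewrite Rintegral_itv_obnd_cbnd//; apply: integrableS fi => //.
exact: subset_itv_oc_cc.
Qed.

Lemma integrable_continuous f (a b : R) : {within `[a, b], continuous f} ->
  leb.-integrable `[a, b] (EFin \o f).
Proof. by move=> cf; apply: continuous_compact_integrable => //; exact: segment_compact. Qed.

Lemma integral_deriv_horner p :
  (\int[leb]_(t in `[0%R, 1%R]) (p^`().[t])%:E = (p.[1] - p.[0])%:E)%E.
Proof.
rewrite (@continuous_FTC2 _ _ (horner p))//.
- exact: continuous_horner_within.
- exact: derivable_oo_horner.
- by move=> t _; rewrite -derivE.
Qed.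

Lemma test_function_ends (eta : R -> R) : test_function 1 eta -> eta 0 = 0 /\ eta 1 = 0.
Proof.
move=> [_ [a [b [a0 b1 eta0]]]].
by split; apply: eta0; rewrite in_itv/= negb_and -!ltNge ?a0 ?b1 ?orbT.
Qed.

Lemma weak_derivative_horner p : weak_derivative 1 (horner p) (horner p^`()).
Proof.
move=> eta teta; have [eta_0 eta_1] := test_function_ends teta.
have d_eta t : derivable eta t 1 by case: teta => /(_ 0%N t).
have c_eta : continuous eta.
  by move=> t; apply/differentiable_continuous/derivable1_diffP.
have c_eta' : continuous (eta^`())%classic.
  move=> t; apply/differentiable_continuous/derivable1_diffP.
  by case: teta => /(_ 1%N t).
have cM (f g : R -> R) : continuous f -> continuous g ->
    leb.-integrable `[0, 1] (EFin \o (fun t => f t * g t)).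
  move=> cf cg; apply: integrable_continuous; apply: continuous_subspaceT => t.
  by apply: cvgM; [exact: cf|exact: cg].
have ch q : continuous (horner q) by move=> t; exact: continuous_horner.
rewrite !Rintegral_oo_cc; [|exact: cM..].
rewrite (@Rintegration_by_parts _ (horner p) eta (horner p^`()) (eta^`())%classic)//.
- by rewrite eta_0 eta_1 !mulr0 subrr sub0r.
- exact: continuous_horner_within.
- exact: derivable_oo_horner.
- by move=> t _; rewrite -derivE.
- exact: continuous_subspaceT.
- split; first by move=> t _; exact: d_eta.
  + by apply: cvg_at_right_filter; exact: c_eta.
  + by apply: cvg_at_left_filter; exact: c_eta.
Qed.

Lemma square_integrable_horner p : square_integrable `]0, 1[ (horner p).
Proof.
split.
  apply: measurable_funTS; apply: continuous_measurable_fun.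
  exact: continuous_horner.
have : leb.-integrable `]0, 1[ (EFin \o (fun t => p.[t] ^+ 2)).
  apply: integrable_cc_oo; apply: integrable_continuous.
  rewrite (_ : (fun t => _) = horner (p ^+ 2)); first exact: continuous_horner_within.
  by apply/funext => t; rewrite horner_exp.
move=> /integrableP[_]; under eq_integral => t _ do rewrite /= ger0_norm ?sqr_ge0//.
exact.
Qed.

Lemma H1_horner p : H1_with_derivative 1 (horner p) (horner p^`()).
Proof.
split; [exact: continuous_horner_within| | |exact: weak_derivative_horner];
  exact: square_integrable_horner.
Qed.

Lemma C1_segment_horner p : C1_segment 1 (horner p).
Proof.
split; first exact: derivable_oo_horner.
exists (horner p^`()); split; first exact: continuous_horner_within.
by move=> t _; rewrite -derivE.
Qed.

End PolynomialsInTime.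

Section DualInterpolation.
Context {R : realType} {X : finType}.
Variables (Q : X -> X -> R) (Lam : R -> R -> R).
Hypothesis HL : admissible_mean Lam.
Hypothesis Q0 : forall x y, 0 <= Q x y.

(** By convexity the Hamiltonian of the interpolant is at most the interpolant of
the Hamiltonians, and the recursion expressing Bernstein polynomials of degree [n]
through those of degree [n - 1] matches this with the derivative. *)
Lemma bernstein_HJ n (c : nat -> X -> R) : discrete_HJ Q Lam n.+1 c ->
  let phi t x := (bernstein n.+1 (fun k => c k x)).[t] in
  HJ Q Lam 1 phi /\ forall x, C1_segment 1 (fun t => phi t x).
Proof.
move=> cHJ phi; split; last by move=> x; exact: C1_segment_horner.
exists (fun t x => (bernstein n.+1 (fun k => c k x))^`().[t]); split.
  by move=> x; exact: H1_horner.
apply: aeW => t; rewrite in_itv/= => /andP[t0 t1] mu pmu.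
have t01 : 0 <= t <= 1 by rewrite !ltW.
have mu_ge0 x : 0 <= mu x by case: pmu.
rewrite -/(hamiltonian Q Lam (phi t) mu).
have jensen : hamiltonian Q Lam (phi t) mu <=
    \sum_(k < n.+2) (bern n.+1 k).[t] * hamiltonian Q Lam (c k) mu.
  rewrite (_ : phi t = fun x => \sum_(k < n.+2) (bern n.+1 k).[t] * c k x).
    by apply: hamiltonian_jensen => // [k _|]; rewrite ?bern_ge0// sum_bern.
  by apply/funext => x; rewrite /phi horner_bernstein; apply: eq_bigr => k _; rewrite mulrC.
apply: le_trans (lerD (lexx _) jensen) _.
rewrite (_ : \sum_(k < n.+2) _ =
    (bernstein n.+1 (fun k => hamiltonian Q Lam (c k) mu)).[t]); last first.
  by rewrite horner_bernstein; apply: eq_bigr => k _; rewrite mulrC.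
rewrite bernsteinS hornerD !hornerM hornerX hornerD hornerN hornerX hornerC.
rewrite !horner_bernstein !mulr_sumr -big_split/=.
rewrite (_ : pairing _ _ = \sum_(k < n.+1) (bern n k).[t] *
    (n.+1%:R * pairing (fun x => c k.+1 x - c k x) mu)); last first.
  transitivity (\sum_(k < n.+1) (bern n k).[t] * n.+1%:R *
     pairing (fun x => c k.+1 x - c k x) mu); last first.
    by apply: eq_bigr => k _; rewrite mulrA.
  rewrite -pairing_suml; congr (pairing _ mu); apply/funext => x.
  rewrite deriv_bernstein hornerZ horner_bernstein mulr_sumr.
  by apply: eq_bigr => k _; ring.
rewrite -big_split/= -oppr_ge0 -sumrN sumr_ge0// => k _; rewrite oppr_ge0.
have := cHJ k false mu (ltn_ord k) pmu; have := cHJ k true mu (ltn_ord k) pmu.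
rewrite /constraint addn0 addn1; set P := _ * pairing _ _.
set h1 := hamiltonian _ _ _ _; set h0 := hamiltonian _ _ _ _ => H1 H0.
rewrite (_ : _ + _ = (bern n k).[t] * ((1 - t) * (P + h0) + t * (P + h1))); last by ring.
rewrite mulr_ge0_le0 ?bern_ge0//; nra.
Qed.

End DualInterpolation.

(** * The transport cost of polynomial flows *)

Section FlowBounds.
Context {R : realType} {X : finType}.
Variables (Q : X -> X -> R) (Lam : R -> R -> R).
Hypothesis HL : admissible_mean Lam.
Hypothesis Q0 : forall x y, 0 <= Q x y.
Hypothesis Qsupp : forall x y, Q x y = 0 -> Q y x = 0.
Local Notation leb := (@lebesgue_measure R).

Lemma action_density_ge0 (s t w : R) : (0 <= action_density Lam s t w)%E.
Proof.
rewrite /action_density; case: ifPn => [/andP[s0 t0]|_]; last by case: ifP.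
by rewrite lee_fin divr_ge0 ?sqr_ge0// ltW// (mean_gt0 HL).
Qed.

Lemma action_ge0 mu V : (0 <= action Q Lam mu V)%E.
Proof.
rewrite /action mule_ge0 ?lee_fin ?invr_ge0// sume_ge0// => x _.
by rewrite sume_ge0// => y _; exact: action_density_ge0.
Qed.

Lemma action_density_le (s t w a : R) : 0 <= s -> 0 <= t -> 0 <= a ->
  w ^+ 2 <= Lam s t * a -> (0 < s /\ 0 < t) \/ w = 0 ->
  (action_density Lam s t w <= a%:E)%E.
Proof.
move=> s0 t0 a0 wa pos; rewrite /action_density; case: ifPn => [/andP[s_gt0 t_gt0]|st].
  by rewrite lee_fin ler_pdivrMr ?(mean_gt0 HL)// mulrC.
case: pos => [[s_gt0 t_gt0]|->]; first by rewrite s_gt0 t_gt0 in st.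
by rewrite eqxx s0 t0 lee_fin.
Qed.

Definition flow_cost (T : X -> X -> {poly R}) : R :=
  2^-1 * (2^-1 * \sum_x \sum_y ((T x y).[1] - (T x y).[0])).

Lemma polynomial_flow_transport mu0 mu1 P W T :
  polynomial_flow Q Lam mu0 mu1 P W T ->
  (forall x t, 0 < t < 1 -> 0 < (P x).[t]) ->
  (forall x y, (W x y).[0] = 0 /\ (W x y).[1] = 0) ->
  ((2^-1)%:E * transport_distance Q Lam mu0 mu1 ^+ 2 <= (flow_cost T)%:E)%E.
Proof.
move=> flowP P_gt0 W01.
pose mu t x := (P x).[t]; pose V t x y := (W x y).[t].
pose A := (\int[leb]_(t in `[0%R, 1%R]) action Q Lam (mu t) (V t))%E.
have A0 : (0 <= A)%E by apply: integral_ge0 => t _; exact: action_ge0.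
have ceP : continuity_eq mu0 mu1 mu V.
  split.
  - by move=> t; rewrite in_itv/=; exact: (pf_prob flowP).
  - by move=> x; exact: continuous_horner_within.
  - by move=> x y; apply: integrable_continuous; exact: continuous_horner_within.
  - by apply/funext => x; exact: (pf_start flowP).
  - by apply/funext => x; exact: (pf_end flowP).
  - move=> x; rewrite (_ : (fun t => - _) = horner (P x)^`()).
      exact: weak_derivative_horner.
    apply/funext => t; rewrite (pf_ce flowP) /divergence -mulrN -sumrN.
    by congr (_ * _); apply: eq_bigr => y _; rewrite opprB.
have td_le : (transport_distance Q Lam mu0 mu1 <= sqrte A)%E.
  by apply: ereal_inf_lbound; exists mu, V.
have td_ge0 : (0 <= transport_distance Q Lam mu0 mu1)%E.
  by apply: le_ereal_inf_tmp => _ [? [? [_ ->]]]; exact: sqrte_ge0.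
have td2 : (transport_distance Q Lam mu0 mu1 ^+ 2 <= A)%E.
  by rewrite -(sqr_sqrte A0) lee_sqr ?sqrte_ge0.
pose S : {poly R} := 2^-1 *: \sum_x \sum_y T x y.
have costE : flow_cost T = 2^-1 * (S.[1] - S.[0]).
  rewrite /flow_cost /S !hornerZ -mulrBr !horner_sum -sumrB; do 2 congr (_ * _).
  by apply: eq_bigr => x _; rewrite !horner_sum -sumrB.
rewrite costE EFinM lee_pmul2l ?fin_numE// ?lte_fin ?invr_gt0//.
apply: le_trans td2 _; rewrite -integral_deriv_horner.
apply: ge0_le_integral_nonmeasurable => t; first by move=> _; exact: action_ge0.
rewrite /= in_itv/= => t01.
have -> : S^`().[t] = 2^-1 * \sum_x \sum_y (T x y)^`().[t].
  rewrite /S derivZ hornerZ (raddf_sum (@deriv R)) horner_sum; congr (_ * _).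
  by apply: eq_bigr => x _; rewrite (raddf_sum (@deriv R)) horner_sum.
rewrite /action EFinM lee_pmul2l ?fin_numE// ?lte_fin ?invr_gt0//.
rewrite -sumEFin; apply: lee_sum => x _; rewrite -sumEFin; apply: lee_sum => y _.
have mu_ge0 z : 0 <= mu t z by case: (pf_prob flowP t01) => /(_ z).
apply: action_density_le.
- by rewrite mulr_ge0.
- by rewrite mulr_ge0.
- exact: (pf_cost_ge0 flowP).
- exact: (pf_cost flowP).
have [->|t0] := eqVneq t 0; first by right; case: (W01 x y).
have [->|t1] := eqVneq t 1; first by right; case: (W01 x y).
have {t0 t1 t01}t01 : 0 < t < 1.
  by move: t01 => /andP[t0' t1']; rewrite !lt_neqAle t0' t1' t1 eq_sym t0.
have [Qxy|Qxy] := eqVneq (Q x y) 0; first by right; exact: (pf_edge flowP).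
left; split; apply: mulr_gt0 (P_gt0 _ _ t01) _; rewrite lt_neqAle Q0 andbT eq_sym//.
by apply: contra Qxy => /eqP/Qsupp ->.
Qed.

Lemma is_prob_comb (a : R) mu mu' : 0 <= a <= 1 -> is_prob mu -> is_prob mu' ->
  is_prob (fun x : X => (1 - a) * mu x + a * mu' x).
Proof.
move=> /andP[a0 a1] [mu_ge0 mu1] [mu'_ge0 mu'1]; split.
  by move=> x; rewrite addr_ge0 ?mulr_ge0 ?subr_ge0.
by rewrite big_split -!mulr_sumr/= mu1 mu'1; ring.
Qed.

Lemma mobility_concave (a : R) mu mu' x y : 0 <= a <= 1 ->
  (forall x, 0 <= mu x) -> (forall x, 0 <= mu' x) ->
  (1 - a) * mobility Q Lam mu x y + a * mobility Q Lam mu' x y <=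
  mobility Q Lam (fun x => (1 - a) * mu x + a * mu' x) x y.
Proof.
move=> /andP[a0 a1] mu_ge0 mu'_ge0; rewrite /mobility.
have e (u v q : R) : ((1 - a) * u + a * v) * q =
  (1 - a) * (u * q) + (1 - (1 - a)) * (v * q) by ring.
rewrite !e -[X in _ + X * _ <= _](subKr 1 a).
by apply: (am_concave HL); rewrite ?subr_ge0 ?gerBl// mulr_ge0.
Qed.

Lemma polynomial_flow_comb (a : R) mu0 mu1 P W T P' W' T' : 0 <= a <= 1 ->
  polynomial_flow Q Lam mu0 mu1 P W T ->
  polynomial_flow Q Lam mu0 mu1 P' W' T' ->
  polynomial_flow Q Lam mu0 mu1 (fun x => (1 - a) *: P x + a *: P' x)
    (fun x y => (1 - a) *: W x y + a *: W' x y)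
    (fun x y => (1 - a) *: T x y + a *: T' x y).
Proof.
move=> a01 F F'; have /andP[a0 a1] := a01.
have hornerE2 (p q : {poly R}) t :
    ((1 - a) *: p + a *: q).[t] = (1 - a) * p.[t] + a * q.[t].
  by rewrite hornerD !hornerZ.
have derivE2 (p q : {poly R}) :
    ((1 - a) *: p + a *: q)^`() = (1 - a) *: p^`() + a *: q^`().
  by rewrite derivD !derivZ.
split.
- move=> t t01; under eq_fun do rewrite hornerE2.
  by apply: is_prob_comb => //; [exact: (pf_prob F)|exact: (pf_prob F')].
- by move=> x; rewrite hornerE2 (pf_start F) (pf_start F'); ring.
- by move=> x; rewrite hornerE2 (pf_end F) (pf_end F'); ring.
- move=> x t; rewrite derivE2 hornerE2 (pf_ce F) (pf_ce F') /divergence.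
  rewrite !(mulrCA _ 2^-1) -mulrDr; congr (_ * _).
  rewrite !mulr_sumr -big_split/=; apply: eq_bigr => y _; rewrite !hornerE2; ring.
- by move=> x y t Qxy; rewrite hornerE2 (pf_edge F)// (pf_edge F')// !mulr0 addr0.
- move=> x y t t01; rewrite derivE2 hornerE2 addr_ge0// mulr_ge0 ?subr_ge0//.
    exact: (pf_cost_ge0 F).
  exact: (pf_cost_ge0 F').
move=> x y t t01; rewrite derivE2 !hornerE2.
under [X in _ <= mobility _ _ X _ _ * _]eq_fun do rewrite hornerE2.
have P_ge0 z : 0 <= (P z).[t] by case: (pf_prob F t01) => /(_ z).
have P'_ge0 z : 0 <= (P' z).[t] by case: (pf_prob F' t01) => /(_ z).
have c0 := pf_cost_ge0 F x y t01; have c'0 := pf_cost_ge0 F' x y t01.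
have m0 := mobility_ge0 HL Q0 x y P_ge0; have m'0 := mobility_ge0 HL Q0 x y P'_ge0.
apply: le_trans (ler_wpM2r _ (mobility_concave x y a01 P_ge0 P'_ge0)); last first.
  by rewrite addr_ge0// mulr_ge0 ?subr_ge0.
apply: cauchy_schwarz2; rewrite ?mulr_ge0 ?subr_ge0//.
- rewrite exprMn [leRHS]mulrACA -(expr2 (1 - a)); apply: ler_wpM2l; first exact: sqr_ge0.
  exact: (pf_cost F).
- rewrite exprMn [leRHS]mulrACA -(expr2 a); apply: ler_wpM2l; first exact: sqr_ge0.
  exact: (pf_cost F').
Qed.

Lemma flow_cost_comb (a : R) T T' :
  flow_cost (fun x y => (1 - a) *: T x y + a *: T' x y) =
  (1 - a) * flow_cost T + a * flow_cost T'.
Proof.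
rewrite /flow_cost !(mulrCA _ 2^-1) -!mulrDr; do 2 congr (_ * _).
rewrite !mulr_sumr -big_split/=; apply: eq_bigr => x _.
rewrite !mulr_sumr -big_split/=; apply: eq_bigr => y _.
by rewrite !hornerD !hornerZ; ring.
Qed.

End FlowBounds.

(** * Near-optimal flows *)

Section ReferenceFlow.
Context {R : realType} {X : finType}.
Variables (Q : X -> X -> R) (p : X -> R) (Lam : R -> R -> R).
Hypothesis HQ : markov_triple Q p.
Hypothesis HL : admissible_mean Lam.

Lemma markov_support x y : Q x y = 0 -> Q y x = 0.
Proof.
move=> Qxy; have := mt_reversible HQ x y; rewrite Qxy mulr0 => /esym/eqP.
by rewrite mulf_eq0 gt_eqF ?(mt_pos HQ)//= => /eqP.
Qed.

Lemma mobility_gt0 mu x y : (forall x, 0 < mu x) -> 0 < Q x y ->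
  0 < mobility Q Lam mu x y.
Proof.
move=> mu_gt0 Qxy; apply: (mean_gt0 HL); rewrite mulr_gt0// lt_neqAle.
rewrite (mt_rate_ge0 HQ) andbT eq_sym; apply/eqP => /markov_support Qxy0.
by rewrite Qxy0 ltxx in Qxy.
Qed.

Lemma constant_potential (v : X -> R) :
  (forall x y, 0 < Q x y -> grad v x y = 0) -> forall x y, v x = v y.
Proof.
move=> v0 x y; have /connectP[s] := mt_irreducible HQ x y.
elim: s x => [x _ ->//|z s IH x /= /andP[xz zs] ylast].
rewrite -(IH z zs ylast); have := v0 _ _ xz; rewrite /grad; lra.
Qed.

(** By irreducibility only the constants are invisible to the mobility of the
stationary measure, and probability measures have the same pairing with them.
The halved mobility leaves room for the weights of two steps. *)
Lemma interior_potential mu mu' : is_prob mu -> is_prob mu' ->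
  exists phi, forall x, mu x - mu' x =
    divergence (flux (fun x y => mobility Q Lam p x y / 2) phi) x.
Proof.
move=> [_ mu1] [_ mu'1]; apply: network_potential.
  move=> x y; rewrite divr_ge0// (mobility_ge0 HL (mt_rate_ge0 HQ))// => z.
  exact/ltW/(mt_pos HQ).
move=> v v0; have vE : forall x y, v x = v y.
  apply: constant_potential => x y Qxy; have := v0 x y => /eqP.
  rewrite mulf_eq0 => /orP[|/eqP//].
  by rewrite gt_eqF// divr_gt0// mobility_gt0// => z; exact: (mt_pos HQ).
have [x0 _|noX] := pickP (fun _ : X => true).
  rewrite /pairing; under eq_bigr => x _ do rewrite (vE x x0).
  by rewrite -mulr_sumr sumrB mu1 mu'1 subrr mulr0.
by rewrite /pairing big1// => x; have := noX x.
Qed.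

(** A flow of finite cost through the interior of the simplex: stay at [mu0], move
to the stationary measure, then to [mu1], and stay there. The repeated endpoints
make the flux vanish to first order where the mobility degenerates. *)
Lemma reference_flow mu0 mu1 : is_prob mu0 -> is_prob mu1 ->
  exists P W T, [/\ polynomial_flow Q Lam mu0 mu1 P W T,
    forall x t, 0 < t < 1 -> 0 < (P x).[t] &
    forall x y, (W x y).[0] = 0 /\ (W x y).[1] = 0].
Proof.
move=> pmu0 pmu1.
have [phi0 phi0E] := interior_potential (mt_prob HQ) pmu0.
have [phi1 phi1E] := interior_potential pmu1 (mt_prob HQ).
pose st j := if (j <= 1)%N then mu0 else if (j == 2)%N then p else mu1.
pose w j x y := if (j == 2)%N then mobility Q Lam p x y / 2 else 0.
pose f i := if (i == 1)%N then grad phi0 else grad phi1.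
have p_ge0 z : 0 <= p z by exact/ltW/(mt_pos HQ).
have st_prob j : is_prob (st j).
  by rewrite /st; case: ifP => // _; case: ifP => // _; exact: (mt_prob HQ).
have mob_ge0 j x y : 0 <= mobility Q Lam (st j) x y.
  by apply: (mobility_ge0 HL (mt_rate_ge0 HQ)) => z; case: (st_prob j).
have w_ge0 j x y : 0 <= w j x y.
  by rewrite /w; case: ifP => // _; rewrite divr_ge0//; exact: (mob_ge0 2%N).
exists (bernstein_mass 2 st), (bernstein_flux 2 w w f), (bernstein_cost 2 w w f 2 1).
split.
- apply: (bernstein_polynomial_flow HL (mt_rate_ge0 HQ) markov_support) => //.
  + move=> j x y _; rewrite mul1r; have := mob_ge0 j x y.
    rewrite /w /st; case: (eqVneq j 2%N) => [->|_ mob0] /=; last by rewrite addr0.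
    move=> _.
    by rewrite -mulr2n -[_ *+ 2]mulr_natr mulfVK// pnatr_eq0.
  + move=> [|[|[|[|i]]]] x y //= _; rewrite /w /=; try by left.
    by right; split => //; rewrite mulr1.
  + move=> [|[|[|[|i]]]] x y //= _; rewrite /w /=; try by left.
    by right; split => //; rewrite mulr1.
  + move=> [|[|[|[|i]]]] x //= _; rewrite /st /step_flux /w /f /=.
    * rewrite subrr /divergence big1 ?mulr0// => y _.
      by rewrite addr0 !mul0r subrr.
    * by rewrite phi0E /divergence; congr (_ * _); apply: eq_bigr => y _; rewrite !addr0.
    * by rewrite phi1E /divergence; congr (_ * _); apply: eq_bigr => y _; rewrite !add0r.
    * rewrite subrr /divergence big1 ?mulr0// => y _.
      by rewrite addr0 !mul0r subrr.
- move=> x t t01; rewrite horner_bernstein.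
  have t01' : 0 <= t <= 1 by case/andP: t01 => t0 t1; rewrite !ltW.
  rewrite (bigD1 (inord 2))//= ltr_wpDr// ?sumr_ge0//.
    by move=> j _; rewrite mulr_ge0 ?bern_ge0//; case: (st_prob j).
  by rewrite inordK// mulr_gt0 ?bern_gt0//; exact: (mt_pos HQ).
- move=> x y; rewrite /bernstein_flux !hornerZ bernstein_at0 bernstein_at1.
  by rewrite /step_flux /w /= !addr0 !mul0r !mulr0.
Qed.

End ReferenceFlow.

Section StrongDuality.
Context {R : realType} {X : finType}.
Variables (Q : X -> X -> R) (p : X -> R) (Lam : R -> R -> R).
Hypothesis HQ : markov_triple Q p.
Hypothesis HL : admissible_mean Lam.
Variables (mu0 mu1 : X -> R).
Hypotheses (Hmu0 : is_prob mu0) (Hmu1 : is_prob mu1).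
Let Q0 := mt_rate_ge0 HQ.

(** The discrete optimal curve, waiting [K] steps at both ends, read as control
points of a Bernstein curve of degree [(K + 1)^2]. The waiting steps keep the
moving part away from the ends, where the ratio of consecutive Bernstein
polynomials is far from constant. *)
Lemma near_optimal_flow (K : nat) (D : R) : (0 < K)%N ->
  (exists m, simplex (K * K) m /\
     forall c, lagrangian Q Lam mu0 mu1 (K * K) c m <= D) ->
  exists P W T, [/\ polynomial_flow Q Lam mu0 mu1 P W T,
    forall x y, (W x y).[0] = 0 /\ (W x y).[1] = 0 &
    flow_cost T <= (K.+1%:R / K%:R) ^+ 3 * D].
Proof.
move=> K0; set n := (K * K)%N => -[m [Zm LD]].
have n0 : (0 < n)%N by rewrite muln_gt0 K0.
have [c [cflow cD]] := discrete_flow HL Q0 Zm LD.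
(* The degree [M.+2] is [(K + 1) ^ 2], so that [M.+2 * C / n] is [C ^ 3]. *)
pose M := (n + K + K).-1.
have MN : M.+2 = (n + 1 + K + K)%N by rewrite /M; lia.
pose st j := state mu0 mu1 n m (j - K).
pose al j := weight Q Lam n m (j - K) false.
pose be j := weight Q Lam n m (j - K) true.
pose f i := grad (c (i - K)%N).
pose C : R := K.+1%:R / K%:R.
have K0' : 0 < K%:R :> R by rewrite ltr0n.
have m_ge0 k e x : 0 <= m (k, e, x) := slice_ge0 k e x Zm.
have state_ge0 j x : 0 <= state mu0 mu1 n m j x.
  case: j => [|j] /=; first by case: Hmu0.
  case: ifP => _; last by case: Hmu1.
  by rewrite mulr_ge0// sumr_ge0.
have state_prob j : is_prob (state mu0 mu1 n m j).
  split=> //; elim: j => [|j IH]; first by case: Hmu0.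
  have [jn|nj] := leqP j n; last by rewrite /= ltnNge (ltnW nj)/=; case: Hmu1.
  rewrite -[RHS]IH; apply/eqP; rewrite -subr_eq0 -sumrB; apply/eqP.
  under eq_bigr do rewrite cflow//.
  exact: sum_divergence.
have w_ge0 j e x y : 0 <= weight Q Lam n m j e x y by exact: (weight_ge0 HL Q0 Zm).
have w_big j e : (n < j)%N -> weight Q Lam n m j e = fun _ _ => 0.
  case: j => // j nj; apply/funext => x; apply/funext => y /=.
  by rewrite ltnNge -ltnS nj.
have w_small e j : (j <= K)%N -> weight Q Lam n m (j - K) e = fun _ _ => 0.
  by rewrite -subn_eq0 => /eqP ->; apply/funext => x; apply/funext => y.
have ratio_le (i : nat) : (K <= i)%N -> i.+1%:R <= C * i%:R.
  move=> Ki; rewrite /C mulrAC ler_pdivlMr// -!natrM ler_nat; nia.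
exists (bernstein_mass M st), (bernstein_flux M al be f), (bernstein_cost M al be f C n%:R).
have step i x : st i.+1 x - st i x = divergence (step_flux al be f i) x.
  rewrite /st /step_flux /al /be /f; have [iK|Ki] := ltnP i K.
    rewrite !w_small ?(ltnW iK)//.
    have -> : (i.+1 - K = 0)%N by lia.
    have -> : (i - K = 0)%N by lia.
    rewrite subrr /divergence big1 ?mulr0// => y _.
    by rewrite !addr0 !mul0r subrr.
  rewrite subSn//; have [kn|nk] := leqP (i - K) n; first by rewrite cflow.
  rewrite !w_big ?(ltnW nk)//; last exact: leqW.
  case: (i - K)%N nk => // k nk /=.
  rewrite !ltnNge (ltnW nk)/= -ltnS nk/= subrr /divergence big1 ?mulr0// => y _.
  by rewrite !addr0 !mul0r subrr.
have st0 : st 0%N = mu0 by [].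
have stN : st M.+2 = mu1.
  rewrite /st MN; have -> : (n + 1 + K + K - K = (n + K).+1)%N by lia.
  by apply/funext => x; rewrite /= ltnNge leq_addr.
have C0 : 0 <= C by rewrite divr_ge0.
split.
- rewrite -[X in polynomial_flow _ _ X]st0 -[X in polynomial_flow _ _ _ X]stN.
  apply: (bernstein_polynomial_flow HL Q0 (markov_support HQ)) => //.
  + by move=> j; exact: state_prob.
  + by move=> j x y; exact: w_ge0.
  + by move=> j x y; exact: w_ge0.
  + by rewrite ltr0n.
  + move=> j x y _; rewrite /al /be /st.
    have [j0|j0] := posnP (j - K).
      rewrite j0 /= addr0 mulr0; apply: (mobility_ge0 HL Q0) => z.
      by case: Hmu0.
    have [jn|nj] := leqP (j - K) n; first by apply: (weight_state HL Q0 mu0 mu1 Zm); rewrite j0.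
    rewrite !w_big// addr0 mulr0; apply: (mobility_ge0 HL Q0) => z; exact: state_ge0.
  + move=> i x y _; have [iK|Ki] := leqP i.+1 K; first by left; rewrite /al w_small.
    by right; split; [lia|exact: ratio_le].
  + move=> i x y iN; have [ni|in_] := ltnP n (i - K); first by left; rewrite /be w_big.
    right; split; first by rewrite /M; lia.
    have -> : (M.+2 - i = (M.+1 - i).+1)%N by rewrite -subSn// /M; lia.
    by apply: ratio_le; rewrite /M; lia.
- move=> x y; rewrite /bernstein_flux !hornerZ bernstein_at0 bernstein_at1.
  rewrite /step_flux /al /be (w_small _ 1%N K0) (w_small _ 0%N (leq0n K)).
  rewrite (w_big (M.+2 - K)%N) ?(w_big (M.+1 - K)%N); [|by rewrite /M; lia..].
  by rewrite !addr0 !mul0r !mulr0.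
have NE : M.+2%:R = K.+1%:R ^+ 2 :> R.
  by rewrite -natrX; congr (_%:R); rewrite MN /n; lia.
have nE : n%:R = K%:R ^+ 2 :> R by rewrite -natrX.
have coefE : M.+2%:R * C / n%:R = C ^+ 3.
  by rewrite NE nE /C; field; rewrite gt_eqF.
have C3 : 0 <= C ^+ 3 by rewrite exprn_ge0.
apply: le_trans (ler_wpM2l C3 cD).
pose E i := energy (fun x y => al i.+1 x y + be i x y) (c (i - K)%N).
apply: (@le_trans _ _ (C ^+ 3 * \sum_(i < M.+2) E i)).
  rewrite /flow_cost /E /energy -!mulr_sumr !(mulrCA (C ^+ 3)) !ler_pM2l ?invr_gt0//.
  rewrite [X in _ <= _ * X]exchange_big/= mulr_sumr ler_sum// => x _.
  rewrite [X in _ <= _ * X]exchange_big/= mulr_sumr ler_sum// => y _.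
  rewrite -coefE; apply: bernstein_cost_le => //.
  - by move=> j z z'; exact: w_ge0.
  - by move=> j z z'; exact: w_ge0.
  - by rewrite ltr0n.
rewrite ler_wpM2l// MN -(big_mkord predT E) (@big_cat_nat _ _ _ K)//=; last by lia.
rewrite big1_seq ?add0r; last first.
  move=> i; rewrite mem_index_iota => /andP[_ /andP[_ iK]].
  rewrite /E /al /be !w_small ?(ltnW iK)//.
  by under eq_fun do under eq_fun do rewrite addr0; rewrite energy0.
rewrite (@big_cat_nat _ _ _ (n + 1 + K)%N)//=; [|by lia|by lia].
rewrite [X in _ + X]big1_seq ?addr0; last first.
  move=> i; rewrite mem_index_iota => /andP[_ /andP[iK _]].
  rewrite /E /al /be !w_big; [|by lia|by lia].
  by under eq_fun do under eq_fun do rewrite addr0; rewrite energy0.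
rewrite -{1}[K]add0n addn1 big_addn addnK big_mkord ler_sum// => k _.
by rewrite /E /al /be -addSn !addnK.
Qed.

End StrongDuality.

(** * Strong duality *)

Section StrongDualityConclusion.
Context {R : realType} {X : finType}.
Variables (Q : X -> X -> R) (p : X -> R) (Lam : R -> R -> R).
Hypothesis HQ : markov_triple Q p.
Hypothesis HL : admissible_mean Lam.
Variables (mu0 mu1 : X -> R).
Hypotheses (Hmu0 : is_prob mu0) (Hmu1 : is_prob mu1).
Let Q0 := mt_rate_ge0 HQ.

Lemma cube_ratio_le (e : R) : 0 < e ->
  exists K : nat, (0 < K)%N /\ (K.+1%:R / K%:R) ^+ 3 <= 1 + e.
Proof.
move=> e0; have [K Ke] : exists K : nat, 7 / e <= K%:R.
  exists (Num.bound (7 / e)); apply/ltW/archi_boundP.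
  by rewrite divr_ge0 ?ltW.
have K0 : 0 < K%:R :> R by apply: lt_le_trans Ke; rewrite divr_gt0.
have K1 : 1 <= K%:R :> R by rewrite ler1n -(ltr0n R).
exists K; split; first by rewrite -(ltr0n R).
have d0 : 0 <= K%:R^-1 :> R by rewrite invr_ge0 ltW.
have d1 : K%:R^-1 <= 1 :> R by rewrite invf_le1.
have d7 : 7 * K%:R^-1 <= e :> R.
  by rewrite ler_pdivrMr// mulrC -ler_pdivrMr.
rewrite -natr1 mulrDl divff ?gt_eqF// mul1r.
move: d0 d1 d7; set d := K%:R^-1 => d0 d1 d7.
(* For [d <= 1] the cube of [1 + d] is at most [1 + 7 * d]. *)
have d2 : d ^+ 2 <= d by rewrite expr2 ler_piMr.
have d3 : d ^+ 3 <= d by rewrite exprS ler_piMr// expr2 mulr_ile1.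
have -> : (1 + d) ^+ 3 = 1 + 3 * d + 3 * d ^+ 2 + d ^+ 3 by ring.
lra.
Qed.

(** A small admixture of the reference flow makes the mass positive at all interior
times, where the action density demands it; its cost is proportional to the
mixing coefficient [a], which is chosen small relative to that cost. *)
Lemma transport_le_dual (D : R) :
  (forall phi, HJ Q Lam 1 phi -> (forall x, C1_segment 1 (fun t => phi t x)) ->
     pairing (phi 1) mu1 - pairing (phi 0) mu0 <= D) ->
  ((2^-1)%:E * transport_distance Q Lam mu0 mu1 ^+ 2 <= D%:E)%E.
Proof.
move=> phiD.
have cD n c : (0 < n)%N -> discrete_HJ Q Lam n c -> objective mu0 mu1 n c <= D.
  case: n => // n _ cHJ; have [phiHJ phiC1] := bernstein_HJ HL Q0 cHJ.
  have := phiD _ phiHJ phiC1; rewrite /objective.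
  under [X in pairing X mu1 - _]eq_fun do rewrite bernstein_at1.
  by under [X in _ - pairing X mu0]eq_fun do rewrite bernstein_at0.
have D0 : 0 <= D.
  have := cD 1%N (fun _ _ => 0) isT; rewrite /objective /pairing.
  rewrite !big1 ?subr0; [|by move=> x _; rewrite mul0r..]; apply.
  move=> k e mu _ _; rewrite /constraint /pairing /hamiltonian /sqnorm.
  have -> : \sum_x (0 - 0) * mu x = 0 :> R.
    by rewrite big1// => x _; rewrite subrr mul0r.
  rewrite mulr0 add0r big1 ?mulr0// => x _; rewrite big1// => y _.
  by rewrite /grad subrr expr0n mul0r.
have [P' [W' [T' [F' P'_gt0 W'01]]]] := reference_flow HQ HL Hmu0 Hmu1.
set c' := flow_cost T'.
have bound (e : R) : 0 < e -> ((2^-1)%:E * transport_distance Q Lam mu0 mu1 ^+ 2 <=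
    ((1 + e) * (D + e) + e)%:E)%E.
  move=> e0; have [K [K0 Ke]] := cube_ratio_le e0.
  have [] := @near_optimal_flow _ _ _ _ _ HQ HL _ _ Hmu0 Hmu1 K (D + e) K0.
    have De : D < D + e by rewrite ltrDl.
    apply: (discrete_minimax HL Q0 Hmu0 Hmu1 _ De); rewrite ?muln_gt0 ?K0//.
    by move=> c; apply: cD; rewrite muln_gt0 K0.
  move=> P [W [T [F W01 TD]]].
  have den : 0 < 1 + `|c'| + e by rewrite ltr_wpDl ?addr_ge0.
  pose a : R := e / (1 + `|c'| + e).
  have a0 : 0 < a by rewrite divr_gt0.
  have a1 : a <= 1 by rewrite ler_pdivrMr// mul1r lerDr addr_ge0.
  have a01 : 0 <= a <= 1 by rewrite ltW.
  have ac : a * c' <= e.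
    rewrite /a mulrAC ler_pdivrMr// ler_pM2l//.
    by have := ler_norm c'; lra.
  have Fa := polynomial_flow_comb HL Q0 a01 F F'.
  apply: le_trans (polynomial_flow_transport HL Q0 (markov_support HQ) Fa _ _) _.
  - move=> x t t01; rewrite hornerD !hornerZ ltr_wpDl//.
      have t01' : 0 <= t <= 1 by case/andP: t01 => t0 t1; rewrite !ltW.
      by rewrite mulr_ge0 ?subr_ge0//; case: (pf_prob F t01') => /(_ x).
    by rewrite mulr_gt0// P'_gt0.
  - move=> x y; rewrite !hornerD !hornerZ.
    have [-> ->] := W01 x y; have [-> ->] := W'01 x y.
    by rewrite !mulr0 addr0.
  rewrite lee_fin flow_cost_comb lerD//.
  apply: le_trans (ler_wpM2l _ TD) _; first by rewrite subr_ge0.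
  have De : 0 <= D + e by rewrite addr_ge0// ltW.
  have r0 : 0 <= (K.+1%:R / K%:R) ^+ 3 * (D + e) by rewrite mulr_ge0// exprn_ge0 ?divr_ge0.
  apply: (@le_trans _ _ ((K.+1%:R / K%:R) ^+ 3 * (D + e))).
    by rewrite ler_piMl// gerBl ltW.
  by rewrite ler_wpM2r.
apply/lee_addgt0Pr => e e0.
(* For [e' <= 1] the bound exceeds [D] by at most [e' * (D + 3)]. *)
pose e' := Num.min 1 (e / (D + 3)).
have D3 : 0 < D + 3 by rewrite ltr_wpDl.
have e'0 : 0 < e' by rewrite lt_min ltr01 divr_gt0.
have e'1 : e' <= 1 by rewrite ge_min lexx.
have e'e : e' * (D + 3) <= e by rewrite -ler_pdivlMr// ge_min lexx orbT.
apply: le_trans (bound _ e'0) _; rewrite -EFinD lee_fin.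
have : e' * e' <= e' by rewrite ler_piMr// ltW.
nra.
Qed.

End StrongDualityConclusion.

(** * The product rule for absolutely continuous functions *)

Section Primitives.
Context {R : realType}.
Local Notation leb := (@lebesgue_measure R).
Implicit Types (F G f g : R -> R) (x a b : R).

Lemma continuous_bounded F : {within `[0, 1], continuous F} ->
  exists C, 0 <= C /\ forall t, 0 <= t <= 1 -> `|F t| <= C.
Proof.
move=> cF; have [u _ uF] := EVT_max ler01 cF; have [v _ vF] := EVT_min ler01 cF.
exists (`|F u| + `|F v|); split; first by rewrite addr_ge0.
move=> t t01; have t01' : t \in `[0, 1] by rewrite in_itv.
have := uF _ t01'; have := vF _ t01'.
have := ler_norm (F u); have := ler_norm (- F v); rewrite normrN ler_norml.
have := normr_ge0 (F u); have := normr_ge0 (F v); lra.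
Qed.

Lemma uniformly_continuous F (e : R) : {within `[0, 1], continuous F} -> 0 < e ->
  exists2 d, 0 < d & forall x y, 0 <= x <= 1 -> 0 <= y <= 1 -> `|x - y| < d ->
    `|F x - F y| <= e.
Proof.
move=> cF e0; have /compact_near_coveringP := @segment_compact R 0 1.
move=> /(_ _ (0 : R)^'+ (fun d x => 0 <= x <= 1 -> forall y, 0 <= y <= 1 ->
   `|x - y| < d -> `|F x - F y| <= e)).
case.
  move=> x; rewrite /= in_itv/= => x01.
  have /subspace_continuousP/(_ x) := cF; rewrite /= in_itv/= => /(_ x01).
  move=> /cvgrPdist_le/(_ (e / 2)); rewrite divr_gt0// => /(_ isT).
  rewrite near_withinE => /nbhs_ballP[d /= d0 dF].
  exists (ball x (d / 2), [set r | r < d / 2])%classic => /=.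
    split; first by apply: nbhsx_ballx; rewrite divr_gt0.
    by apply: nbhs_right_lt; rewrite divr_gt0.
  move=> [x' r] /= [xx' rd] x'01 y y01 x'y.
  have h1 : `|F x - F x'| <= e / 2.
    apply: dF; rewrite ?in_itv//= /ball_ /=.
    by apply: lt_le_trans xx' _; rewrite ler_pdivrMr// ler_pMr// ler1n.
  have h2 : `|F x - F y| <= e / 2.
    have xy : `|x - y| < d.
      apply: le_lt_trans (ler_distD x' _ _) _; rewrite [d]splitr ltrD//.
      exact: lt_trans x'y rd.
    by apply: dF; rewrite ?in_itv.
  apply: le_trans (ler_distD (F x) _ _) _; rewrite [e]splitr lerD//.
  by rewrite distrC.
move=> d /= d0 dF; exists (d / 2); first by rewrite divr_gt0.
move=> x y x01 y01 xy.
apply: (dF (d / 2)) => //=.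
- by rewrite /ball_/= sub0r normrN gtr0_norm ?divr_gt0// ltr_pdivrMr// ltr_pMr// ltr1n.
- by rewrite divr_gt0.
Qed.

End Primitives.

Section ProductRule.
Context {R : realType}.
Local Notation leb := (@lebesgue_measure R).
Implicit Types (F G f g : R -> R) (x a b : R).

Definition integrable01 g : Prop := leb.-integrable `[0, 1] (EFin \o g).

Definition primitive g x : R := \int[leb]_(t in `[0, x]) g t.

Lemma primitive0 g : primitive g 0 = 0.
Proof. by rewrite /primitive set_itv1 Rintegral_set1. Qed.

Lemma integrable01_sub g a b : 0 <= a -> b <= 1 -> integrable01 g ->
  leb.-integrable `]a, b] (EFin \o g).
Proof.
move=> a0 b1; apply: integrableS => // t; rewrite /= !in_itv/= => /andP[at_ tb].
by rewrite (le_trans a0 (ltW at_)) (le_trans tb b1).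
Qed.

Lemma primitiveB g a b : 0 <= a -> a <= b -> b <= 1 -> integrable01 g ->
  primitive g b - primitive g a = \int[leb]_(t in `]a, b]) g t.
Proof.
move=> a0 ab b1 gi; apply: Rintegral_itvB; rewrite ?bnd_simp//.
by apply: integrableS gi => //; apply: subset_itvl; rewrite bnd_simp.
Qed.

Lemma integrable01D f g : integrable01 f -> integrable01 g ->
  integrable01 (fun t => f t + g t).
Proof. by move=> fi gi; exact: (integrableD _ fi gi). Qed.

Lemma integrable01B f g : integrable01 f -> integrable01 g ->
  integrable01 (fun t => f t - g t).
Proof. by move=> fi gi; exact: (integrableB _ fi gi). Qed.

Lemma integrable01_norm g : integrable01 g -> integrable01 (fun t => `|g t|).
Proof. by move=> gi; exact: integrable_norm. Qed.

Lemma integrable01_mul F g : {within `[0, 1], continuous F} -> integrable01 g ->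
  integrable01 (fun t => F t * g t).
Proof.
move=> cF gi; have [C [C0 FC]] := continuous_bounded cF.
have mF : measurable_fun (`[0, 1]%classic : set R) F.
  by apply/measurable_EFinP; case/integrableP : (integrable_continuous cF).
have mg : measurable_fun (`[0, 1]%classic : set R) g.
  by apply/measurable_EFinP; case/integrableP : gi.
have Cgi : leb.-integrable `[0, 1] (EFin \o (fun t => C * g t)).
  rewrite (_ : EFin \o _ = (fun t => C%:E * (EFin \o g) t)%E); first exact: integrableZl.
  by apply/funext => t; rewrite /= EFinM.
apply: le_integrable Cgi => //.
  by apply/measurable_EFinP; exact: measurable_funM.
move=> t; rewrite /= in_itv/= => t01.
by rewrite lee_fin !normrM ler_wpM2r// (ger0_norm C0) FC.
Qed.

(** Absolute continuity on the unit interval. *)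
Record has_density F g : Prop := HasDensity {
  hd_continuous : {within `[0, 1], continuous F} ;
  hd_integrable : integrable01 g ;
  hd_primitive : forall x, 0 <= x <= 1 -> F x = F 0 + primitive g x
}.

Lemma has_density_increment F g a b : 0 <= a -> a <= b -> b <= 1 -> has_density F g ->
  F b - F a = \int[leb]_(t in `]a, b]) g t.
Proof.
move=> a0 ab b1 Fg; rewrite -primitiveB//; last exact: (hd_integrable Fg).
rewrite (hd_primitive Fg) ?(le_trans a0 ab)// [F a](hd_primitive Fg) ?a0 ?(le_trans ab)//.
ring.
Qed.

Lemma primitive_has_density g : integrable01 g -> has_density (primitive g) g.
Proof.
move=> gi; split => //; first exact: parameterized_integral_continuous.
by move=> x _; rewrite primitive0 add0r.
Qed.

Definition product_density F f G g t : R := G t * f t + F t * g t.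

Lemma integrable_product_density F f G g : has_density F f -> has_density G g ->
  integrable01 (product_density F f G g).
Proof.
move=> [cF fi _] [cG gi _].
by apply: integrable01D; exact: integrable01_mul.
Qed.

(** On a short cell the product rule fails by the oscillation of the functions
times the mass of the densities. *)
Lemma product_rule_cell F f G g a b (e : R) : 0 <= a -> a <= b -> b <= 1 ->
    has_density F f -> has_density G g -> 0 <= e ->
    (forall t, a <= t <= b -> `|F t - F a| <= e) ->
    (forall t, a <= t <= b -> `|G t - G b| <= e) ->
  `|F b * G b - F a * G a - (primitive (product_density F f G g) b -
     primitive (product_density F f G g) a)| <=
  e * (primitive (fun t => `|f t| + `|g t|) b - primitive (fun t => `|f t| + `|g t|) a).
Proof.
move=> a0 ab b1 Ff Gg e0 Fe Ge.
have fi := hd_integrable Ff; have gi := hd_integrable Gg.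
have ni := integrable01D (integrable01_norm fi) (integrable01_norm gi).
have prod_i := integrable_product_density Ff Gg.
rewrite !primitiveB//.
have sub h : integrable01 h -> leb.-integrable `]a, b] (EFin \o h).
  exact: integrable01_sub.
have cst_mul (c : R) h : integrable01 h -> integrable01 (fun t => c * h t).
  move=> hi; apply: integrable01_mul => //.
  by apply: continuous_subspaceT => t; exact: cvg_cst.
rewrite (_ : F b * G b - F a * G a = G b * (F b - F a) + F a * (G b - G a)); last by ring.
rewrite (has_density_increment a0 ab b1 Ff) (has_density_increment a0 ab b1 Gg).
rewrite -!RintegralZl//; [|exact: sub..].
rewrite -RintegralD//; [|apply: sub; exact: cst_mul..].
rewrite -RintegralB//; [|apply: sub..]; last first.
- exact: prod_i.
- exact: integrable01D (cst_mul _ _ _) (cst_mul _ _ _).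
have di : integrable01 (fun t => G b * f t + F a * g t - product_density F f G g t).
  exact: integrable01B (integrable01D (cst_mul _ _ fi) (cst_mul _ _ gi)) prod_i.
apply: le_trans (le_normr_Rintegral _ (sub _ di)) _ => //.
apply: le_Rintegral => //.
- by apply: sub; exact: integrable01_norm.
- by apply: sub; exact: cst_mul.
move=> t; rewrite /= in_itv/= => /andP[/ltW at_ tb].
rewrite /product_density (_ : _ - _ = - ((G t - G b) * f t + (F t - F a) * g t)); last by ring.
rewrite normrN mulrDr (le_trans (ler_normD _ _))// !normrM lerD//.
  by rewrite ler_wpM2r// Ge// at_.
by rewrite ler_wpM2r// Fe// at_.
Qed.

(** The errors of the cells add up to the oscillation of the functions at the mesh
size of the partition times the total mass of the densities. *)
Lemma product_rule F f G g : has_density F f -> has_density G g ->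
  F 1 * G 1 - F 0 * G 0 = \int[leb]_(t in `[0, 1]) (G t * f t + F t * g t).
Proof.
move=> Ff Gg; rewrite -[RHS]/(primitive (product_density F f G g) 1).
set P := primitive _; pose M := primitive (fun t => `|f t| + `|g t|).
have M0 : 0 <= M 1 by apply: Rintegral_ge0 => t _; rewrite addr_ge0.
suff bound e : 0 < e -> `|F 1 * G 1 - F 0 * G 0 - P 1| <= e * M 1.
  apply/eqP; rewrite -subr_eq0 -normr_le0; apply/ler_addgt0Pr => e e0.
  have M1 : 0 < M 1 + 1 by rewrite ltr_wpDl.
  rewrite add0r; apply: le_trans (bound (e / (M 1 + 1)) _) _; first by rewrite divr_gt0.
  by rewrite mulrAC ler_pdivrMr// ler_pM2l// lerDl.
move=> e0.
have [d1 d10 Fd1] := uniformly_continuous (hd_continuous Ff) e0.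
have [d2 d20 Gd2] := uniformly_continuous (hd_continuous Gg) e0.
pose d := Num.min d1 d2; have d0 : 0 < d by rewrite lt_min d10.
have [N Nd] : exists N : nat, N.+1%:R^-1 < d.
  exists (Num.bound d^-1); rewrite invf_plt ?posrE//.
  apply: lt_trans (archi_boundP _) _; first by rewrite invr_ge0 ltW.
  by rewrite ltr_nat.
pose c (k : nat) : R := k%:R / N.+1%:R.
have c0 k : 0 <= c k by rewrite divr_ge0.
have cS k : c k.+1 = c k + N.+1%:R^-1 by rewrite /c -natr1 mulrDl mul1r.
have c1 k : (k <= N.+1)%N -> c k <= 1.
  by move=> kN; rewrite /c ler_pdivrMr// mul1r ler_nat.
have step k : (k <= N.+1)%N ->
    `|F (c k) * G (c k) - F 0 * G 0 - P (c k)| <= e * M (c k).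
  elim: k => [_|k IH kN].
    by rewrite /c mul0r /P /M !primitive0 mulr0 subr0 subrr normr0.
  have ck : c k <= c k.+1 by rewrite cS lerDl invr_ge0.
  have cell t : c k <= t <= c k.+1 -> [/\ 0 <= t <= 1, `|t - c k| < d & `|t - c k.+1| < d].
    move=> /andP[kt tk]; split.
    - by rewrite (le_trans (c0 k) kt) (le_trans tk)// c1.
    - rewrite ger0_norm ?subr_ge0// (le_lt_trans _ Nd)// lerBlDl.
      by rewrite cS in tk.
    - rewrite ler0_norm ?subr_le0// opprB (le_lt_trans _ Nd)// cS.
      by rewrite lerBlDr addrC lerD2l.
  have := @product_rule_cell F f G g (c k) (c k.+1) e (c0 k) ck (c1 _ kN) Ff Gg (ltW e0) _ _.
  rewrite -/P -/M => cellP.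
  rewrite (_ : _ - P (c k.+1) = (F (c k) * G (c k) - F 0 * G 0 - P (c k)) +
    (F (c k.+1) * G (c k.+1) - F (c k) * G (c k) - (P (c k.+1) - P (c k)))); last by ring.
  rewrite (_ : e * M (c k.+1) = e * M (c k) + e * (M (c k.+1) - M (c k))); last by ring.
  apply: le_trans (ler_normD _ _) _; apply: lerD; first exact: IH (ltnW kN).
  apply: cellP => t /cell[t01 tk tk1].
    apply: Fd1 => //; first by rewrite c0 c1// ltnW.
    by apply: lt_le_trans tk _; rewrite ge_min lexx.
  apply: Gd2 => //; first by rewrite c0 c1.
  by apply: lt_le_trans tk1 _; rewrite ge_min lexx orbT.
have := step N.+1 (leqnn _).
by rewrite /c divff// pnatr_eq0.
Qed.

End ProductRule.

(** * Test functions *)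

Section Flat.
Context {R : realType}.
Implicit Types (P : {poly R}) (x t a b : R).

(** Polynomials in the inverse times the exponential of minus the inverse,
extended by zero: this family is stable under differentiation. *)
Definition flat P x : R := if 0 < x then P.[x^-1] * expR (- x^-1) else 0.

Definition flat_deriv P : {poly R} := 'X^2 * (P - P^`()).

Lemma flatN P x : flat (- P) x = - flat P x.
Proof. by rewrite /flat; case: ifP => _; rewrite ?oppr0// hornerN mulNr. Qed.

Lemma flat_linear_bound P :
  exists A, 0 <= A /\ forall x, 0 < x <= 1 -> `|flat P x| <= A * x.
Proof.
pose S := \sum_(i < size P) `|P`_i|; pose n := size P.
have S0 : 0 <= S by apply: sumr_ge0.
exists (S * n.+1`!%:R); split; first by rewrite mulr_ge0.
move=> x /andP[x0 x1]; rewrite /flat x0.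
have y1 : 1 <= x^-1 by rewrite invf_ge1.
have y0 : 0 <= x^-1 by rewrite (le_trans _ y1).
have Py : `|P.[x^-1]| <= S * x^-1 ^+ n.
  rewrite horner_coef /S mulr_suml (le_trans (ler_norm_sum _ _ _))// ler_sum// => i _.
  rewrite normrM ler_wpM2l// normrX ger0_norm// ler_weXn2l//.
  by rewrite /n ltnW.
have fact0 : 0 < n.+1`!%:R :> R by rewrite ltr0n fact_gt0.
have ey : x^-1 ^+ n.+1 / n.+1`!%:R <= expR x^-1.
  by apply: le_trans (expR_ge1Dxn n y0); rewrite lerDr.
have ey' : expR (- x^-1) * x^-1 ^+ n <= n.+1`!%:R * x.
  rewrite expRN -ler_pdivlMl ?invr_gt0 ?expR_gt0// invrK.
  rewrite -(@ler_pM2r _ (x^-1 / n.+1`!%:R)) ?divr_gt0 ?invr_gt0//.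
  rewrite mulrA -exprSr; apply: le_trans ey _.
  by rewrite le_eqVlt; apply/orP; left; apply/eqP; field; rewrite !gt_eqF.
rewrite normrM (ger0_norm (expR_ge0 _)).
apply: le_trans (ler_wpM2r (expR_ge0 _) Py) _.
by rewrite -!mulrA ler_wpM2l// mulrC.
Qed.

Lemma is_derive_horner P x : is_derive x 1 (horner P) (P^`().[x]).
Proof.
have e : 'D_1 (horner P) x = P^`().[x] by rewrite -derive1E -derivE.
rewrite -e; apply/derivableP; exact: derivable_horner.
Qed.

Lemma is_derive_flat P x : is_derive x 1 (flat P) (flat (flat_deriv P) x).
Proof.
have [x0|x0|->] := ltgtP x 0.
- rewrite /flat ltNge (ltW x0)/=.
  have d0 : is_derive x (1 : R) (cst (0 : R)) 0 by exact: is_derive_cst.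
  apply: near_eq_is_derive d0.
  by near=> z; rewrite /flat ltNge ltW//; near: z; exact: lt_nbhsl x0.
- have xn0 : x != 0 by rewrite gt_eqF.
  have dV : is_derive x 1 (fun z : R => z^-1) (- x ^- 2).
    by have := @is_deriveV R id x 1 1 xn0 (is_derive_id _ _);
      rewrite /GRing.scale/= mulr1.
  have dP : is_derive x 1 (fun z => P.[z^-1]) (P^`().[x^-1] * - x ^- 2).
    exact: is_derive1_comp (is_derive_horner P x^-1) dV.
  have dN : is_derive x 1 (fun z : R => - z^-1) (x ^- 2).
    by have := is_deriveN dV; rewrite opprK.
  have dE : is_derive x 1 (fun z : R => expR (- z^-1)) (expR (- x^-1) * x ^- 2).
    exact: is_derive1_comp (is_derive_expR _) dN.
  have dM : is_derive x 1 (fun z => P.[z^-1] * expR (- z^-1)) (flat (flat_deriv P) x).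
    apply: (is_derive_eq (is_deriveM dP dE)).
    rewrite /flat x0 /flat_deriv !hornerE /= /GRing.scale/=.
    by rewrite exprVn; ring.
  apply: near_eq_is_derive dM.
  by near=> z; rewrite /flat ifT//; near: z; exact: lt_nbhsr.
have [A [A0 PA]] := flat_linear_bound (P * 'X).
have quot : h^-1 *: ((flat P \o shift 0) (h *: 1) - flat P 0) @[h --> (0:R)^'] --> (0:R).
  apply/cvgrPdist_le => e e0; near=> h.
  have h0 : h != 0 by near: h; exact: nbhs_dnbhs_neq.
  rewrite /= addr0 [h *: 1]mulr1 sub0r normrN {2}/flat ltxx subr0.
  rewrite /flat; case: ifPn => [h_gt0|_]; last by rewrite scaler0 normr0 ltW.
  have -> : h^-1 *: (P.[h^-1] * expR (- h^-1)) = flat (P * 'X) h.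
    by rewrite /flat h_gt0 !hornerE /= /GRing.scale/=; ring.
  have hA : `|h| < (Num.min 1 (e / (A + 1))).
    near: h; apply: dnbhs0_lt; rewrite lt_min ltr01 divr_gt0//.
    by rewrite ltr_wpDl.
  rewrite gtr0_norm// lt_min in hA; case/andP: hA => h1 hA.
  have A1 : 0 < A + 1 by rewrite ltr_wpDl.
  apply: le_trans (PA h _) _; first by rewrite h_gt0 ltW.
  apply: (@le_trans _ _ ((A + 1) * h)).
    by rewrite ler_wpM2r ?lerDl// ltW.
  by rewrite mulrC -ler_pdivlMr// ltW.
have f0 : flat (flat_deriv P) 0 = 0 by rewrite /flat ltxx.
rewrite f0; apply: DeriveDef; first by apply/cvg_ex; exists 0.
exact: cvg_lim.
Unshelve. all: by end_near. Qed.

End Flat.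

Section TestFunctions.
Context {R : realType}.
Local Notation leb := (@lebesgue_measure R).
Implicit Types (a b x t : R).

(** An atom [(a, b, P, S)] stands for a product of two flat functions that is
supported between [a] and [b]. *)
Definition bump_atom := (R * R * {poly R} * {poly R})%type.

Definition atom_fun (q : bump_atom) (t : R) : R :=
  flat q.1.2 (t - q.1.1.1) * flat q.2 (q.1.1.2 - t).

Definition bump_sum (s : seq bump_atom) (t : R) : R := \sum_(q <- s) atom_fun q t.

Definition atom_deriv (q : bump_atom) : seq bump_atom :=
  [:: (q.1.1, flat_deriv q.1.2, q.2); (q.1.1, q.1.2, - flat_deriv q.2)].

Lemma is_derive_atom (q : bump_atom) t : is_derive t 1 (atom_fun q)
  (bump_sum (atom_deriv q) t).
Proof.
have d1 : is_derive t (1 : R) (fun t : R => t - q.1.1.1) 1.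
  by have := is_deriveB (is_derive_id t (1 : R)) (is_derive_cst q.1.1.1 t (1 : R)); rewrite subr0.
have d2 : is_derive t (1 : R) (fun t : R => q.1.1.2 - t) (- 1).
  by have := is_deriveB (is_derive_cst q.1.1.2 t (1 : R)) (is_derive_id t (1 : R)); rewrite sub0r.
have f1 := is_derive1_comp (g := fun t => t - q.1.1.1)
  (is_derive_flat q.1.2 (t - q.1.1.1)) d1.
have f2 := is_derive1_comp (g := fun t => q.1.1.2 - t)
  (is_derive_flat q.2 (q.1.1.2 - t)) d2.
apply: (is_derive_eq (is_deriveM f1 f2)).
rewrite /bump_sum /atom_deriv big_cons big_cons big_nil /atom_fun /= flatN.
by rewrite /GRing.scale/=; ring.
Qed.

Lemma is_derive_bump s t : is_derive t 1 (bump_sum s)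
  (bump_sum (flatten [seq atom_deriv q | q <- s]) t).
Proof.
elim: s => [|q s IH].
  rewrite /bump_sum/= big_nil (_ : (fun _ => _) = cst 0); first exact: is_derive_cst.
  by apply/funext => u; rewrite big_nil.
have -> : bump_sum (q :: s) = atom_fun q + bump_sum s.
  by apply/funext => u; rewrite /bump_sum big_cons.
have -> : bump_sum (flatten [seq atom_deriv q | q <- q :: s]) t =
    bump_sum (atom_deriv q) t + bump_sum (flatten [seq atom_deriv q | q <- s]) t.
  by rewrite /bump_sum -big_cat.
exact: is_deriveD (is_derive_atom q t) IH.
Qed.

Lemma continuous_bump s : continuous (bump_sum s).
Proof.
by move=> x; apply/differentiable_continuous/derivable1_diffP;
  have [] := is_derive_bump s x.
Qed.

Lemma derivable_derive1n_bump s n t : derivable ((bump_sum s)^`(n))%classic t 1.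
Proof.
elim: n s => [|n IH] s; first by have [] := is_derive_bump s t.
rewrite derive1Sn (_ : (bump_sum s)^`()%classic =
  bump_sum (flatten [seq atom_deriv q | q <- s])); first exact: IH.
by apply/funext => u; rewrite derive1E; have [_ ->] := is_derive_bump s u.
Qed.

Definition unit_atom a b (c : R) : bump_atom := (a, b, c%:P, 1).

Lemma atom_fun_out (q : bump_atom) t : (t <= q.1.1.1) || (q.1.1.2 <= t) ->
  atom_fun q t = 0.
Proof.
rewrite /atom_fun /flat; case/orP => h; first by rewrite subr_gt0 ltNge h mul0r.
by rewrite [X in _ * (if X then _ else _)]subr_gt0 [t < _]ltNge h mulr0.
Qed.

Lemma unit_atomE a b c t : atom_fun (unit_atom a b c) t =
  c * atom_fun (unit_atom a b 1) t.
Proof.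
rewrite /atom_fun /flat /=; case: ifP => _; last by rewrite !mul0r mulr0.
by rewrite !hornerC; ring.
Qed.

Lemma unit_atom_gt0 a b t : a < t < b -> 0 < atom_fun (unit_atom a b 1) t.
Proof.
move=> /andP[at_ tb]; rewrite /atom_fun /flat /= !subr_gt0 at_ tb !hornerC !mul1r.
by rewrite mulr_gt0 ?expR_gt0.
Qed.

Lemma unit_atom_ge0 a b t : 0 <= atom_fun (unit_atom a b 1) t.
Proof.
have [at_|ta] := ltP a t; last by rewrite atom_fun_out ?ta.
have [tb|bt] := ltP t b; last by rewrite atom_fun_out ?bt ?orbT.
by rewrite ltW// unit_atom_gt0// at_.
Qed.

Lemma continuous_atom q : continuous (atom_fun q).
Proof.
by move=> x; apply/differentiable_continuous/derivable1_diffP;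
  have [] := is_derive_atom q x.
Qed.

Lemma integrable_atom q a b : leb.-integrable `[a, b] (EFin \o atom_fun q).
Proof. by apply: integrable_continuous; apply: continuous_subspaceT; exact: continuous_atom. Qed.

Lemma Rintegral_atom q (u v : R) : u <= q.1.1.1 -> q.1.1.2 <= v ->
  \int[leb]_(t in `[u, v]) atom_fun q t =
  \int[leb]_(t in `[q.1.1.1, q.1.1.2]) atom_fun q t.
Proof.
move=> ua bv.
rewrite (_ : `[q.1.1.1, q.1.1.2]%classic = `[u, v] `&` `[q.1.1.1, q.1.1.2]); last first.
  rewrite setIidr// => t; rewrite /= !in_itv/= => /andP[at_ tb].
  by rewrite (le_trans ua at_) (le_trans tb bv).
rewrite Rintegral_mkcondr; apply: eq_Rintegral => t _.
rewrite patchE; case: ifPn => //; rewrite notin_setE /= in_itv/= => /negP.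
by rewrite negb_and -!ltNge => h; rewrite atom_fun_out//; case/orP: h => /ltW ->; rewrite ?orbT.
Qed.

Definition atom_mass a b : R := \int[leb]_(t in `[a, b]) atom_fun (unit_atom a b 1) t.

Lemma atom_mass_gt0 a b : a < b -> 0 < atom_mass a b.
Proof.
move=> ab; pose r := atom_fun (unit_atom a b 1).
pose F x := \int[leb]_(t in `[a, x]) r t.
have cF : {within `[a, b], continuous F}.
  by apply: parameterized_integral_continuous; [exact: ltW|exact: integrable_atom].
have dF x : x \in `]a, b[ -> is_derive x 1 F (r x).
  rewrite in_itv/= => /andP[ax xb].
  have [dFx dFE] := continuous_FTC1_closed xb (integrable_atom (unit_atom a b 1) a b) ax
    (@continuous_atom _ x).
  by rewrite /r -dFE derive1E; exact/derivableP.
have [c cab] := MVT ab dF cF.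
rewrite {2}/F set_itv1 Rintegral_set1 subr0 => FE.
rewrite /atom_mass -/r -/(F b) FE mulr_gt0 ?subr_gt0//.
by apply: unit_atom_gt0; rewrite in_itv in cab.
Qed.

End TestFunctions.

(** * Weak derivatives and densities *)

Section WeakDerivative.
Context {R : realType}.
Local Notation leb := (@lebesgue_measure R).
Implicit Types (a b c d x t : R).

Definition mollifier a b : R -> R := atom_fun (unit_atom a b (atom_mass a b)^-1).

Lemma mollifier_ge0 a b t : a < b -> 0 <= mollifier a b t.
Proof.
move=> ab; rewrite /mollifier unit_atomE mulr_ge0 ?unit_atom_ge0//.
by rewrite invr_ge0 ltW// atom_mass_gt0.
Qed.

Lemma mollifier_out a b t : (t <= a) || (b <= t) -> mollifier a b t = 0.
Proof. exact: (@atom_fun_out _ (unit_atom a b (atom_mass a b)^-1)). Qed.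

Lemma Rintegral_mollifier a b (u v : R) : a < b -> u <= a -> b <= v ->
  \int[leb]_(t in `[u, v]) mollifier a b t = 1.
Proof.
move=> ab ua bv.
rewrite (@Rintegral_atom _ (unit_atom a b (atom_mass a b)^-1))//=.
under eq_Rintegral do rewrite unit_atomE.
rewrite RintegralZl//; last exact: integrable_atom.
by rewrite mulVf// gt_eqF// atom_mass_gt0.
Qed.

(** The derivative of a test function rising on [a, b] and falling on [c, d]. *)
Definition plateau_deriv a b c d (t : R) : R := mollifier a b t - mollifier c d t.

(** The lower limit lies to the left of the supports, so that the points of the unit
interval are interior to the domain of integration. *)
Definition plateau a b c d (x : R) : R :=
  \int[leb]_(t in `[-1, x]) plateau_deriv a b c d t.

Lemma plateau_derivE a b c d : plateau_deriv a b c d =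
  bump_sum [:: unit_atom a b (atom_mass a b)^-1; unit_atom c d (- (atom_mass c d)^-1)].
Proof.
apply/funext => t; rewrite /plateau_deriv /bump_sum !big_cons big_nil addr0.
by rewrite /mollifier; congr (_ + _); rewrite unit_atomE [RHS]unit_atomE mulNr.
Qed.

Lemma plateau_left a b c d x : x <= a -> x <= c -> plateau a b c d x = 0.
Proof.
move=> xa xc; transitivity (\int[leb]_(t in `[-1, x]) (0 : R)); last first.
  by rewrite Rintegral_cst// mul0r.
apply: eq_Rintegral => t; rewrite inE/= in_itv/= => /andP[_ tx].
by rewrite /plateau_deriv !mollifier_out ?subr0// ?(le_trans tx xa)// (le_trans tx xc).
Qed.

Lemma plateau_right a b c d x : a < b -> c < d -> -1 <= a -> -1 <= c ->
  b <= x -> d <= x -> plateau a b c d x = 0.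
Proof.
move=> ab cd a1 c1 bx dx; rewrite /plateau /plateau_deriv.
rewrite RintegralB//; [|exact: integrable_atom..].
by rewrite -[RHS](subrr 1); congr (_ - _); exact: Rintegral_mollifier.
Qed.

Lemma is_derive_plateau a b c d x : 0 < a -> 0 < c ->
  is_derive x 1 (plateau a b c d) (plateau_deriv a b c d x).
Proof.
move=> a0 c0; have [x1|x1] := leP x (- 1).
  have x0 : x < 0 by apply: le_lt_trans x1 _; rewrite ltrN10.
  rewrite /plateau_deriv !mollifier_out; last 2 first.
  - by rewrite (ltW (lt_trans x0 c0)).
  - by rewrite (ltW (lt_trans x0 a0)).
  rewrite subr0; have d0 : is_derive x (1 : R) (cst (0 : R)) 0 by exact: is_derive_cst.
  apply: near_eq_is_derive d0; near=> z.
  have z0 : z < 0 by near: z; exact: lt_nbhsl x0.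
  by rewrite plateau_left// ltW// (lt_trans z0).
have xu : x < x + 1 by rewrite ltrDl.
have cont : continuous (plateau_deriv a b c d).
  by rewrite plateau_derivE; exact: continuous_bump.
have int1 : leb.-integrable `[-1, x + 1] (EFin \o plateau_deriv a b c d).
  by apply: integrable_continuous; exact: continuous_subspaceT.
have [dF dFE] := continuous_FTC1_closed xu int1 x1 (cont x).
by rewrite -dFE derive1E; exact/derivableP.
Unshelve. all: by end_near. Qed.

Lemma plateau_test_function a b c d : 0 < a -> a < b -> b < 1 ->
  0 < c -> c < d -> d < 1 -> test_function 1 (plateau a b c d).
Proof.
move=> a0 ab b1 c0 cd d1; split.
  case=> [|n] t; first by have [] := @is_derive_plateau a b c d t a0 c0.
  rewrite derive1Sn (_ : (plateau a b c d)^`()%classic = plateau_deriv a b c d).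
    by rewrite plateau_derivE; exact: derivable_derive1n_bump.
  by apply/funext => u; rewrite derive1E; have [_ ->] := @is_derive_plateau a b c d u a0 c0.
exists (Num.min a c), (Num.max b d); split.
- by rewrite lt_min a0.
- by rewrite gt_max b1.
move=> t; rewrite in_itv/= negb_and -!ltNge => /orP[|].
  by rewrite lt_min => /andP[ta tc]; rewrite plateau_left// ltW.
rewrite gt_max => /andP[bt dt]; rewrite plateau_right ?ltW//.
- by rewrite (lt_trans _ a0)// ltrN10.
- by rewrite (lt_trans _ c0)// ltrN10.
Qed.

Lemma mollified_close a b (w : R -> R) (e : R) : 0 <= a -> a < b -> b <= 1 ->
  {within `[0, 1], continuous w} ->
  (forall t, a <= t <= b -> `|w t - w a| <= e) ->
  `|\int[leb]_(t in `[0, 1]) (w t * mollifier a b t) - w a| <= e.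
Proof.
move=> a0 ab b1 cw we.
have mi : integrable01 (mollifier a b) by exact: integrable_atom.
have wmi := integrable01_mul cw mi.
have cst_mul (k : R) : integrable01 (fun t => k * mollifier a b t).
  apply: integrable01_mul => //.
  by apply: continuous_subspaceT => t; exact: cvg_cst.
rewrite (_ : w a = \int[leb]_(t in `[0, 1]) (w a * mollifier a b t)); last first.
  by rewrite RintegralZl// Rintegral_mollifier// mulr1.
rewrite -RintegralB//; last exact: cst_mul.
have di := integrable01B wmi (cst_mul (w a)).
apply: le_trans (le_normr_Rintegral _ di) _ => //.
have -> : e = \int[leb]_(t in `[0, 1]) (e * mollifier a b t).
  by rewrite RintegralZl// Rintegral_mollifier// mulr1.
apply: le_Rintegral => //; [exact: integrable01_norm|exact: cst_mul|].
move=> t _; rewrite -mulrBl normrM (ger0_norm (mollifier_ge0 _ ab)).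
have [at_|ta] := leP a t; last by rewrite mollifier_out ?(ltW ta)// !mulr0.
have [tb|bt] := leP t b; last by rewrite mollifier_out ?(ltW bt) ?orbT// !mulr0.
by rewrite ler_wpM2r ?mollifier_ge0// we// at_.
Qed.

Lemma residual_orthogonal (f g eta eta' : R -> R) :
  {within `[0, 1], continuous f} -> integrable01 g -> has_density eta eta' ->
  eta 0 = 0 -> eta 1 = 0 ->
  (\int[leb]_(t in `]0, 1[) (f t * eta' t) =
     - \int[leb]_(t in `]0, 1[) (g t * eta t)) ->
  \int[leb]_(t in `[0, 1]) ((f t - primitive g t) * eta' t) = 0.
Proof.
move=> cf gi deta eta0 eta1; have Gg := primitive_has_density gi.
have pr := product_rule Gg deta; rewrite eta0 eta1 !mulr0 subrr in pr.
have i1 := integrable01_mul cf (hd_integrable deta).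
have i2 := integrable01_mul (hd_continuous deta) gi.
have i3 := integrable01_mul (hd_continuous Gg) (hd_integrable deta).
under [X in _ = - X -> _]eq_Rintegral do rewrite mulrC.
rewrite (Rintegral_oo_cc i1) (Rintegral_oo_cc i2) => wk.
rewrite (RintegralD _ i2 i3)// in pr.
under eq_Rintegral do rewrite mulrBl.
by rewrite (RintegralB _ i1 i3)// wk; move: pr => /esym; lra.
Qed.

(** The lemma of du Bois-Reymond. After subtracting the primitive of [g], the
function integrates to zero against all
derivatives of test functions, in particular against differences of
mollifiers, so that its values at any two points agree. *)
Lemma weak_derivative_density (f g : R -> R) : {within `[0, 1], continuous f} ->
  integrable01 g -> weak_derivative 1 f g -> has_density f g.
Proof.
move=> cf gi fg; have Gg := primitive_has_density gi.
have cG := hd_continuous Gg.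
pose w t := f t - primitive g t.
have cw : {within `[0, 1], continuous w} by move=> t; apply: cvgB; [exact: cf|exact: cG].
have w_test a b c d : 0 < a -> a < b -> b < 1 -> 0 < c -> c < d -> d < 1 ->
    \int[leb]_(t in `[0, 1]) (w t * mollifier a b t) =
    \int[leb]_(t in `[0, 1]) (w t * mollifier c d t).
  move=> a0 ab b1 c0 cd d1.
  pose eta := plateau a b c d; pose eta' := plateau_deriv a b c d.
  have teta := plateau_test_function a0 ab b1 c0 cd d1.
  have eta'E : (eta^`())%classic = eta'.
    by apply/funext => u; rewrite derive1E; have [_ ->] := @is_derive_plateau a b c d u a0 c0.
  have c_eta' : {within `[0, 1], continuous eta'}.
    by apply: continuous_subspaceT; rewrite /eta' plateau_derivE; exact: continuous_bump.
  have c_eta : {within `[0, 1], continuous eta}.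
    apply: continuous_subspaceT => u; apply/differentiable_continuous/derivable1_diffP.
    by have [] := @is_derive_plateau a b c d u a0 c0.
  have [eta0 eta1] : eta 0 = 0 /\ eta 1 = 0 := test_function_ends teta.
  have eta_density : has_density eta eta'.
    split => //; first exact: integrable_continuous.
    move=> x /andP[x0 x1]; rewrite eta0 add0r.
    move: x0; rewrite le_eqVlt => /predU1P[<-|x0]; first by rewrite eta0 primitive0.
    rewrite /primitive /Rintegral (@continuous_FTC2 _ _ eta)//=.
    - by rewrite eta0 subr0.
    - by apply: continuous_subspaceT; rewrite /eta' plateau_derivE; exact: continuous_bump.
    - have de u : derivable eta u 1 by have [] := @is_derive_plateau a b c d u a0 c0.
      have ce : continuous eta.
        by move=> u; apply/differentiable_continuous/derivable1_diffP.
      by split=> [u _|  |]; [exact: de|apply: cvg_at_right_filter; exact: ce|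
        apply: cvg_at_left_filter; exact: ce].
    - by move=> u _; rewrite eta'E.
  have fge : \int[leb]_(t in `]0, 1[) (f t * eta' t) =
      - \int[leb]_(t in `]0, 1[) (g t * eta t).
    by have := fg _ teta; rewrite -/eta eta'E.
  have wd := residual_orthogonal cf gi eta_density eta0 eta1 fge.
  have m1 : integrable01 (mollifier a b) by exact: integrable_atom.
  have m2 : integrable01 (mollifier c d) by exact: integrable_atom.
  have w1 := integrable01_mul cw m1; have w2 := integrable01_mul cw m2.
  apply/eqP; rewrite -subr_eq0 -(RintegralB _ w1 w2)//; apply/eqP; rewrite -[RHS]wd.
  by apply: eq_Rintegral => t _; rewrite /eta' /plateau_deriv mulrBr.
have w_close x (e : R) : 0 < x < 1 -> 0 < e -> exists b, [/\ x < b, b < 1 &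
    `|\int[leb]_(t in `[0, 1]) (w t * mollifier x b t) - w x| <= e].
  move=> /andP[x0 x1] e0; have [r r0 wr] := uniformly_continuous cw e0.
  pose b := x + Num.min (r / 2) ((1 - x) / 2).
  have x1' : 0 < 1 - x by rewrite subr_gt0.
  have xb : x < b by rewrite ltrDl lt_min !divr_gt0.
  have b1 : b < 1.
    rewrite /b -ltrBrDl gt_min; apply/orP; right.
    by rewrite ltr_pdivrMr// ltr_pMr// ltr1n.
  have br : b - x < r.
    rewrite /b addrAC subrr add0r gt_min; apply/orP; left.
    by rewrite ltr_pdivrMr// ltr_pMr// ltr1n.
  exists b; split => //; apply: mollified_close => //; [exact: ltW|exact: ltW|].
  move=> t /andP[xt tb]; apply: wr.
  - by rewrite (le_trans (ltW x0) xt) (le_trans tb (ltW b1)).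
  - by rewrite !ltW.
  - rewrite ger0_norm ?subr_ge0//; apply: le_lt_trans br; by rewrite lerD2r.
have w_cst x y : 0 < x < 1 -> 0 < y < 1 -> w x = w y.
  move=> x01 y01; apply/eqP; rewrite -subr_eq0 -normr_le0; apply/ler_addgt0Pr => e e0.
  have e2 : 0 < e / 2 by rewrite divr_gt0.
  have [b [xb b1 wb]] := w_close x _ x01 e2.
  have [d [yd d1 wd]] := w_close y _ y01 e2.
  have /andP[x0 _] := x01; have /andP[y0 _] := y01.
  rewrite (w_test x b y d)// in wb.
  rewrite add0r; apply: le_trans (ler_distD
    (\int[leb]_(t in `[0, 1]) (w t * mollifier y d t)) _ _) _.
  by rewrite [e]splitr lerD// distrC.
have w_end x : 0 <= x <= 1 -> w x = w 2^-1.
  move=> x01; apply/eqP; rewrite -subr_eq0 -normr_le0; apply/ler_addgt0Pr => e e0.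
  have [r r0 wr] := uniformly_continuous cw e0.
  have h01 : 0 < (2^-1 : R) < 1 by rewrite invr_gt0 ltr0n/= invf_lt1 ?ltr1n.
  (* The point [x + l * (2^-1 - x)] lies in the open interval and close to [x]. *)
  pose l := Num.min (2^-1) (r / 2).
  have l0 : 0 < l by rewrite lt_min invr_gt0 ltr0n/= divr_gt0.
  have l1 : l < 1.
    by rewrite gt_min; apply/orP; left; case/andP: h01.
  have lr : l < r.
    by rewrite gt_min; apply/orP; right; rewrite ltr_pdivrMr// ltr_pMr// ltr1n.
  pose y := x + l * (2^-1 - x).
  have y01 : 0 < y < 1.
    have -> : y = (1 - l) * x + l * 2^-1 by rewrite /y; ring.
    case/andP: x01 => x0 x1; case/andP: h01 => h0 h1; apply/andP; split.
      by rewrite ltr_wpDl ?mulr_gt0// mulr_ge0 ?subr_ge0 ?(ltW l1).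
    rewrite -[ltRHS](subrK l); apply: ler_ltD.
      by rewrite ler_piMr ?subr_ge0 ?(ltW l1).
    by rewrite gtr_pMr.
  rewrite add0r -(w_cst y 2^-1 y01 h01); apply: wr => //.
    by case/andP: y01 => ? ?; rewrite !ltW.
  rewrite /y opprD addrA subrr add0r normrN normrM (gtr0_norm l0).
  apply: le_lt_trans lr; rewrite ler_piMr ?(ltW l0)// ler_norml.
  case/andP: x01 => x0 x1; case/andP: h01 => h0 h1; apply/andP; split; lra.
split => // x x01.
have := w_end x x01; rewrite -(w_end 0) ?lexx ?ler01// /w primitive0 subr0 => <-.
by rewrite subrK.
Qed.

End WeakDerivative.

(** * Weak duality *)

Section WeakDuality.
Context {R : realType} {X : finType}.
Variables (Q : X -> X -> R) (Lam : R -> R -> R).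
Hypothesis HL : admissible_mean Lam.
Hypothesis Q0 : forall x y, 0 <= Q x y.
Local Notation leb := (@lebesgue_measure R).

(** Young's inequality for the convex conjugate pair formed by the action density
and the weighted square. *)
Lemma action_density_young (s t w g : R) : 0 <= s -> 0 <= t ->
  ((2 * g * w - g ^+ 2 * Lam s t)%:E <= action_density Lam s t w)%E.
Proof.
move=> s0 t0; have L0 := mean_ge0 HL s0 t0.
rewrite /action_density; case: ifPn => [/andP[s_gt0 t_gt0]|_].
  have L_gt0 := mean_gt0 HL s_gt0 t_gt0.
  rewrite lee_fin ler_pdivlMr//; have := sqr_ge0 (w - g * Lam s t); nra.
case: ifPn => [/and3P[/eqP -> _ _]|_]; last by rewrite leey.
by rewrite lee_fin mulr0 sub0r oppr_le0 mulr_ge0 ?sqr_ge0.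
Qed.

Lemma action_young (mu phi : X -> R) (V : X -> X -> R) : (forall x, 0 <= mu x) ->
  ((2 * pairing phi (divergence V) - sqnorm Q Lam mu (grad phi))%:E <=
   action Q Lam mu V)%E.
Proof.
move=> mu0; rewrite pairing_divergence mulrA mulfV ?pnatr_eq0// mul1r /sqnorm.
have -> : \sum_x \sum_y grad phi x y * V x y - 2^-1 *
      \sum_x \sum_y grad phi x y ^+ 2 * Lam (mu x * Q x y) (mu y * Q y x) =
    2^-1 * \sum_x \sum_y (2 * grad phi x y * V x y -
      grad phi x y ^+ 2 * Lam (mu x * Q x y) (mu y * Q y x)).
  under [in RHS]eq_bigr do rewrite sumrB.
  rewrite sumrB mulrBr; congr (_ - _).
  rewrite mulr_sumr; apply: eq_bigr => x _; rewrite mulr_sumr.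
  by apply: eq_bigr => y _; field.
rewrite /action EFinM lee_pmul2l ?fin_numE// ?lte_fin ?invr_gt0//.
rewrite -sumEFin; apply: lee_sum => x _; rewrite -sumEFin; apply: lee_sum => y _.
by apply: action_density_young; rewrite mulr_ge0.
Qed.

Lemma square_integrable_integrable01 (g : R -> R) :
  square_integrable `]0, 1[ g -> integrable01 g.
Proof.
move=> [mg g2]; have mg01 : measurable_fun (`[0, 1]%classic : set R) g.
  exact: measurable_fun_itv_cc mg.
have mg2 : measurable_fun (`]0, 1[%classic : set R) (fun t => g t ^+ 2).
  exact: measurable_funX.
have ig2 : leb.-integrable `]0, 1[ (EFin \o (fun t => g t ^+ 2)).
  apply/integrableP; split; first exact/measurable_EFinP.
  by under eq_integral => t _ do rewrite /= ger0_norm ?sqr_ge0//.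
have i1 : leb.-integrable `]0, 1[ (EFin \o (fun=> 1 : R)).
  apply: integrable_cc_oo; apply: integrable_continuous.
  by apply: continuous_subspaceT => t; exact: cvg_cst.
have ig : leb.-integrable `]0, 1[ (EFin \o g).
  apply: le_integrable (integrableD _ i1 ig2) => //; first exact/measurable_EFinP.
  move=> t _; rewrite /= lee_fin.
  rewrite [leRHS]ger0_norm ?addr_ge0 ?sqr_ge0//.
  have := sqr_ge0 (`|g t| - 1); have := normr_ge0 (g t).
  have := real_normK (num_real (g t)); nra.
apply/integrableP; split; first exact/measurable_EFinP.
have mag (D : set R) : measurable_fun D g -> measurable_fun D (fun t => `|(EFin \o g) t|%E).
  by move=> mgD; apply: measurableT_comp => //; exact/measurable_EFinP.
rewrite -integral_itv_obnd_cbnd; last first.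
  by apply: mag; exact: measurable_fun_itv_oc mg.
rewrite -integral_itv_bndo_bndc; last by apply: mag.
by case/integrableP : ig.
Qed.

(** The comparison holds off a null set only and the larger function need not be
measurable, so the smaller one is first truncated to zero on that null set. *)
Lemma ge0_le_integral_ae01 (h : R -> R) (a : R -> \bar R) :
  integrable01 h -> (forall t, 0 <= a t)%E ->
  {ae leb, forall t, t \in `]0, 1[ -> ((h t)%:E <= a t)%E} ->
  (\int[leb]_(t in `[0%R, 1%R]) (h t)%:E <= \int[leb]_(t in `[0%R, 1%R]) a t)%E.
Proof.
move=> hi a0 [N [mN N0 subN]].
pose N' : set R := N `|` ([set 0] `|` [set 1]).
have mN' : measurable N' by apply: measurableU => //; apply: measurableU.
have N'0 : leb N' = 0%E.
  rewrite /N' measureU0//; first exact: measurableU.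
  by rewrite measureU0//; exact: lebesgue_measure_set1.
pose k t : \bar R := (Num.max (h t) 0)%:E.
pose k' := k \_ (~` N').
have mh : measurable_fun (`[0, 1]%classic : set R) h.
  by apply/measurable_EFinP; case/integrableP : hi.
have mk : measurable_fun (`[0, 1]%classic : set R) k.
  by apply/measurable_EFinP; apply: measurable_maxr => //; exact: measurable_cst.
have k0 t : (0 <= k t)%E by rewrite lee_fin le_max lexx orbT.
have k'0 t : (0 <= k' t)%E by rewrite /k' patchE; case: ifP.
have mk' : measurable_fun (`[0, 1]%classic : set R) k'.
  apply/(measurable_restrict _ (measurableC mN')) => //.
  by apply: measurable_funS mk => //; exact: subIsetl.
apply: (@le_trans _ _ (\int[leb]_(t in `[0%R, 1%R]) k t)%E).
  apply: le_integral => //.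
    apply: le_integrable hi => //= t _.
    rewrite lee_fin; case: (leP 0 (h t)) => // _; by rewrite normr0.
  by move=> t _; rewrite lee_fin le_max lexx.
apply: (@le_trans _ _ (\int[leb]_(t in `[0%R, 1%R]) k' t)%E).
  rewrite le_eqVlt; apply/orP; left; apply/eqP; apply: ge0_ae_eq_integral => //.
  exists N'; split => // t /=; rewrite not_implyE => -[_ kk'].
  apply: contrapT => N't; apply: kk'.
  by rewrite /k' patchE ifT// inE.
apply: ge0_le_integral_nonmeasurable => t; first by [].
rewrite /= in_itv/= => /andP[t0 t1]; rewrite /k' patchE; case: ifPn => //.
rewrite inE => N't; have t01 : t \in `]0, 1[.
  rewrite in_itv/= !lt_neqAle t0 t1 !andbT; apply/andP; split.
    by apply/eqP => t_0; apply: N't; right; left.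
  by apply/eqP => t_1; apply: N't; right; right.
have ht : ((h t)%:E <= a t)%E.
  have : ~ N t by move=> Nt; apply: N't; left.
  by move=> Nt; apply: contrapT => nh; apply: Nt; apply: subN => /= /(_ t01).
by rewrite /k; case: (leP 0 (h t)).
Qed.

(** The product rule writes the difference of the pairings as the integral of the
time derivative of the pairing of [phi] with [mu]; the subsolution property and
Young's inequality bound this derivative by half the action. *)
Lemma dual_le_action (mu0 mu1 : X -> R) mu V phi :
  continuity_eq mu0 mu1 mu V -> HJ Q Lam 1 phi ->
  ((2 * (pairing (phi 1) mu1 - pairing (phi 0) mu0))%:E <=
   \int[leb]_(t in `[0%R, 1%R]) action Q Lam (mu t) (V t))%E.
Proof.
move=> ce [dphi [phiH1 phiHJ]].
pose v x t := divergence (V t) x.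
have vi x : integrable01 (v x).
  rewrite /integrable01 /v /divergence.
  have sumi : leb.-integrable `[0, 1]
      (fun t => \sum_y ((V t y x)%:E - (V t x y)%:E)%E).
    by apply: integrable_sum => // y _; apply: integrableB => //; exact: (ce_integrable ce).
  have := integrableZl _ (2^-1 : R) sumi; move=> /(_ (measurable_itv _)).
  by congr (leb.-integrable _ _); apply/funext => t; rewrite /= EFinM -sumEFin;
    congr (_ * _)%E; apply: eq_bigr => y _; rewrite EFinB.
have mu_density x : has_density (fun t => mu t x) (v x).
  apply: weak_derivative_density => //; first exact: (ce_continuous ce).
  have := ce_eq ce x; congr weak_derivative; apply/funext => t.
  rewrite /v /divergence -mulrN -sumrN; congr (_ * _).
  by apply: eq_bigr => y _; rewrite opprB.
have phi_density x : has_density (fun t => phi t x) (fun t => dphi t x).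
  have [cphi _ sphi wphi] := phiH1 x.
  by apply: weak_derivative_density => //; exact: square_integrable_integrable01.
pose h x t := mu t x * dphi t x + phi t x * v x t.
have hi x : integrable01 (h x).
  exact: (integrable_product_density (phi_density x) (mu_density x)).
have hE x : phi 1 x * mu1 x - phi 0 x * mu0 x = \int[leb]_(t in `[0, 1]) h x t.
  by rewrite -(product_rule (phi_density x) (mu_density x)) (ce_start ce) (ce_end ce).
have sum_i : integrable01 (fun t => \sum_x h x t).
  rewrite /integrable01 (_ : EFin \o _ = fun t => (\sum_x (h x t)%:E)%E).
    by apply: integrable_sum => // x _; exact: hi.
  by apply/funext => t; rewrite /= sumEFin.
have sum_2i : integrable01 (fun t => 2 * \sum_x h x t).
  apply: integrable01_mul sum_i.
  by apply: continuous_subspaceT => t; exact: cvg_cst.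
have -> : (2 * (pairing (phi 1) mu1 - pairing (phi 0) mu0))%:E =
    (\int[leb]_(t in `[0%R, 1%R]) (2 * \sum_x h x t)%R%:E)%E.
  rewrite -[RHS]fineK; last exact: (integrable_fin_num _ sum_2i).
  rewrite -/(Rintegral _ _ _) RintegralZl//; congr (_ * _)%:E.
  rewrite /pairing -sumrB; under eq_bigr do rewrite hE.
  rewrite /Rintegral; under [X in _ = fine X]eq_integral do rewrite -sumEFin.
  rewrite integral_sum//.
  by rewrite -EFin_sum_fine// => x _; exact: (integrable_fin_num _ (hi x)).
apply: ge0_le_integral_ae01 => //; first by move=> t; exact: action_ge0.
case: phiHJ => N [mN N0 subN]; exists N; split => // t nt; apply: subN => /= HJt.
apply: nt => t01.
have t01' : t \in `[0, 1] by move: t01; rewrite !in_itv/= => /andP[? ?]; rewrite !ltW.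
have pmu := ce_prob ce t01'.
apply: le_trans (action_young (phi t) (V t) _); last by case: pmu.
have := HJt t01 _ pmu; rewrite lee_fin /h big_split/=.
have -> : \sum_x mu t x * dphi t x = pairing (dphi t) (mu t).
  by apply: eq_bigr => x _; rewrite mulrC.
have -> : \sum_x phi t x * v x t = pairing (phi t) (divergence (V t)) by [].
lra.
Qed.

Lemma dual_le_transport (mu0 mu1 : X -> R) phi : HJ Q Lam 1 phi ->
  ((pairing (phi 1) mu1 - pairing (phi 0) mu0)%:E <=
   (2^-1)%:E * transport_distance Q Lam mu0 mu1 ^+ 2)%E.
Proof.
move=> phiHJ; set c := _ - _.
have td_ge0 : (0 <= transport_distance Q Lam mu0 mu1)%E.
  by apply: le_ereal_inf_tmp => _ [? [? [_ ->]]]; exact: sqrte_ge0.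
have [c0|c0] := leP 0 c; last first.
  apply: (@le_trans _ _ 0%E); first by rewrite lee_fin ltW.
  by rewrite mule_ge0 ?lee_fin ?invr_ge0// sqre_ge0.
have c2 : (0 <= (2 * c)%:E)%E by rewrite lee_fin mulr_ge0.
have : (sqrte (2 * c)%:E <= transport_distance Q Lam mu0 mu1)%E.
  apply: le_ereal_inf_tmp => _ [mu [V [ce ->]]].
  have A0 : (0 <= \int[leb]_(t in `[0%R, 1%R]) action Q Lam (mu t) (V t))%E.
    by apply: integral_ge0 => t _; exact: action_ge0.
  by rewrite lee_sqrt//; exact: dual_le_action ce phiHJ.
rewrite -lee_sqr ?sqrte_ge0// sqr_sqrte// => c_le.
rewrite (_ : c%:E = ((2^-1)%:E * (2 * c)%:E)%E).
  by rewrite lee_pmul2l ?fin_numE// lte_fin invr_gt0.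
by rewrite -EFinM mulrA mulVf ?pnatr_eq0// mul1r.
Qed.

End WeakDuality.

(** * The duality theorem *)

Theorem theorem3p3 (R : realType) (X : finType)
    (Q : X -> X -> R) (p : X -> R) (Lam : R -> R -> R)
    (HQ : markov_triple Q p) (HLam : admissible_mean Lam)
    (mu0 mu1 : X -> R) (Hmu0 : is_prob mu0) (Hmu1 : is_prob mu1) :
  ((2^-1)%:E * transport_distance Q Lam mu0 mu1 ^+ 2 =
   ereal_sup [set (pairing (phi 1%R) mu1 - pairing (phi 0%R) mu0)%:E
             | phi in [set phi : R -> X -> R | HJ Q Lam 1 phi]])%E
  /\
  ((2^-1)%:E * transport_distance Q Lam mu0 mu1 ^+ 2 =
   ereal_sup [set (pairing (phi 1%R) mu1 - pairing (phi 0%R) mu0)%:E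
             | phi in [set phi : R -> X -> R | HJ Q Lam 1 phi /\
                 forall x, C1_segment 1 (fun t => phi t x)]])%E.
Proof.
set W2 := (_ * _)%E; set S := ereal_sup _; set S1 := ereal_sup _.
have S1S : (S1 <= S)%E.
  by apply: le_ereal_sup => _ [phi [phiHJ _] <-]; exists phi.
have SW : (S <= W2)%E.
  apply: ge_ereal_sup => _ [phi phiHJ <-].
  exact: (dual_le_transport HLam (mt_rate_ge0 HQ)).
have WS1 : (W2 <= S1)%E.
  have bound (D : R) : (S1 <= D%:E)%E -> (W2 <= D%:E)%E.
    move=> S1D; apply: (transport_le_dual HQ HLam Hmu0 Hmu1) => phi phiHJ phiC1.
    rewrite -lee_fin; apply: le_trans S1D.
    by apply: ereal_sup_ubound; exists phi.
  have W2_ge0 : (0 <= W2)%E by rewrite mule_ge0 ?lee_fin ?invr_ge0// sqre_ge0.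
  (* The value [-oo] is excluded because the distance is nonnegative. *)
  case: S1 bound {S1S} => [D bound|_|bound]; [exact: bound|exact: leey|].
  have := le_trans W2_ge0 (bound (- 1) (leNye _)).
  by rewrite lee_fin lerNr oppr0 ler10.
by split; apply/eqP; rewrite eq_le; apply/andP; split;
  [exact: le_trans WS1 S1S|exact: SW|exact: WS1|exact: le_trans S1S SW].
Qed.
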